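(* For every $v>0$, the normal distribution $N(0,v)$ with mean $0$ and variance $v$ is Boolean selfdecomposable.
   Context: For a Borel probability measure $\mu$ on $\mathbb{R}$ put $G_\mu(z)=\int_{\mathbb{R}}\frac{1}{z-x}\,\mu(dx)$, $F_\mu(z)=1/G_\mu(z)$ and $K_\mu(z)=z-F_\mu(z)$ for $z$ in the open upper half-plane $\mathbb{C}^+$. For any two probability measures $\mu,\nu$ on $\mathbb{R}$, the Boolean convolution $\mu\uplus\nu$ is the unique probability measure on $\mathbb{R}$ with $K_{\mu\uplus\nu}=K_\mu+K_\nu$ on $\mathbb{C}^+$. For $c\in\mathbb{R}$, $D_c(\mu)$ is the push-forward of $\mu$ by $x\mapsto cx$. A probability measure $\mu$ on $\mathbb{R}$ is Boolean selfdecomposable if for every $c\in(0,1)$ there is a probability measure $\mu_c$ on $\mathbb{R}$ with $\mu=D_c(\mu)\uplus\mu_c$. *)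

(* Defs.v *)
From HB Require Import structures.
From mathcomp Require Import all_boot all_order all_algebra.
From mathcomp Require Import complex.
From mathcomp Require Import all_classical all_reals all_analysis.
From mathcomp Require Import measurable_realfun.

Set Implicit Arguments.
Unset Strict Implicit.
Unset Printing Implicit Defensive.

Import Order.TTheory GRing.Theory Num.Theory numFieldNormedType.Exports.

Local Open Scope classical_set_scope.
Local Open Scope complex_scope.
Local Open Scope ring_scope.

Section transforms.
Context {R : realType}.
Implicit Types (mu nu rho : probability (measurableTypeR R) R) (z : R[i]).

(* The complex integral is taken componentwise. For 0 < Im z the integrand is
   continuous and bounded, so both components are integrable. *)
Definition cauchy_transform mu z : R[i] :=
  (\int[mu]_x complex.Re (1 / (z - x%:C)))%R +i*
  (\int[mu]_x complex.Im (1 / (z - x%:C)))%R.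

Definition F_transform mu z : R[i] := 1 / cauchy_transform mu z.

Definition K_transform mu z : R[i] := z - F_transform mu z.

(* [rho] is the Boolean convolution of [mu] and [nu]. The relation is
   functional in [rho], because a probability measure is determined by its
   K-transform on the open upper half-plane. *)
Definition is_boolean_convolution mu nu rho : Prop :=
  forall z, 0 < complex.Im z ->
    K_transform rho z = K_transform mu z + K_transform nu z.

End transforms.

Section dilation.
Context {R : realType}.

Definition scale (c : R) : measurableTypeR R -> measurableTypeR R :=
  fun x => c * x.

Fact measurable_scale (c : R) : measurable_fun setT (scale c).
Proof. exact: mulrl_measurable. Qed.

HB.instance Definition _ (c : R) :=
  isMeasurableFun.Build _ _ _ _ (scale c) (measurable_scale c).

Definition dilation (c : R) (mu : probability (measurableTypeR R) R) :
    probability (measurableTypeR R) R :=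
  distribution mu (scale c).

End dilation.

Definition boolean_selfdecomposable (R : realType)
    (mu : probability (measurableTypeR R) R) : Prop :=
  forall c : R, 0 < c < 1 ->
    exists mu_c : probability (measurableTypeR R) R,
      is_boolean_convolution (dilation c mu) mu_c mu.

(* Main.v *)
Require Import Defs.
From HB Require Import structures.
From mathcomp Require Import all_boot all_order all_algebra.
From mathcomp Require Import complex.
From mathcomp Require Import ring lra.
From mathcomp Require Import all_classical all_reals all_analysis.
From mathcomp Require Import measurable_realfun.

Set Implicit Arguments.
Unset Strict Implicit.
Unset Printing Implicit Defensive.

Import Order.TTheory GRing.Theory Num.Theory numFieldNormedType.Exports.

Local Open Scope classical_set_scope.
Local Open Scope complex_scope.
Local Open Scope ring_scope.

(** Since the K-transform of [dilation c mu] is [c K(z / c)], the cofactor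
    [mu_c] must have F-transform [F_c(z) = z + c K(z / c) - K(z)], where [K] is
    the K-transform of the Gaussian; by scaling, variance 1 is enough. The
    point is to show that [1 / F_c] is the Cauchy transform of a probability
    measure.

    The tool is Poisson's formula for bounded functions that are holomorphic
    in the upper half-plane and continuous up to the line
    ([poisson_formula_Re]). It is proved by deforming the line to the given
    point through hyperbolic circles: the Poisson mean over the circles does
    not change. Applied to [(w - z) h(w)] as well, it yields Cauchy's formula,
    so that a function [h] with [h(z) ~ - 1 / z] at infinity and
    [Im h >= 0] on the line is minus the Cauchy transform of the probability
    measure of density [Im h / pi] ([cauchy_transform_realization]).

    The Gaussian transform extends to the entire function
    [G(z) = - i int_0^oo e^(i z t - t^2 / 2) dt]. Integration by parts gives
    [G' = 1 - z G] and the behaviour at infinity, and Cauchy's formula applied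
    to [- G] identifies it with the transform of the normal law
    ([cauchy_transform_normal]). As [Im G < 0] on the closed half-plane,
    [K = z - 1 / G] extends continuously to the line and is bounded.

    Everything then rests on the sign of [Im (c K(x / c) - K(x))] for real
    [x], that is, on the monotonicity of [x |G(x)|^2 e^(x^2 / 2)] for [x > 0]
    ([reciprocal_levy_increasing]). On the line
    [G = r - i sqrt (pi / 2) e^(- x^2 / 2)] with [r' = 1 - x r], [r 0 = 0], a
    rescaled Dawson function, and comparison for this equation gives
    [x / (1 + x^2) <= r <= 2 x / (1 + x^2)], which is sharp enough to make
    the derivative positive. Finally Poisson's formula carries
    [Im (F_c - z) >= 0] from the line to the half-plane, so [F_c] has no zero
    and [h = - 1 / F_c] can be realized. *)

(** * Modulus, limits and holomorphy of complex functions *)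

Section complex_basics.
Context {R : realType}.
Implicit Types (z w l : R[i]) (x y : R).

Definition modulus z : R := ComplexField.Normc.normc z.

Arguments modulus : simpl never.

Lemma modulusE z :
  modulus z = Num.sqrt (complex.Re z ^+ 2 + complex.Im z ^+ 2).
Proof. by case: z. Qed.

Lemma modulus_ge0 z : 0 <= modulus z.
Proof. by rewrite modulusE sqrtr_ge0. Qed.

Lemma modulusM z w : modulus (z * w) = modulus z * modulus w.
Proof. exact: ComplexField.Normc.normcM. Qed.

Lemma modulusD z w : modulus (z + w) <= modulus z + modulus w.
Proof. exact: le_normcD. Qed.

Lemma modulusN z : modulus (- z) = modulus z.
Proof. by rewrite !modulusE; case: z => a b /=; rewrite !sqrrN. Qed.

Lemma modulusB z w : modulus (z - w) <= modulus z + modulus w.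
Proof. by rewrite (le_trans (modulusD _ _))// modulusN. Qed.

Lemma modulusV z : modulus z^-1 = (modulus z)^-1.
Proof. exact: ComplexField.Normc.normcV. Qed.

Lemma modulus0 : modulus 0 = 0 :> R.
Proof. exact: ComplexField.Normc.normc0. Qed.

Lemma modulus1 : modulus 1 = 1 :> R.
Proof. exact: ComplexField.Normc.normc1. Qed.

Lemma modulusX z n : modulus (z ^+ n) = modulus z ^+ n.
Proof.
elim: n => [|n IHn]; first exact: modulus1.
by rewrite !exprS modulusM IHn.
Qed.

Lemma modulus_real x : modulus x%:C = `|x|.
Proof. by rewrite modulusE /= expr0n addr0 sqrtr_sqr. Qed.

Lemma modulusi : modulus 'i = 1 :> R.
Proof. by rewrite modulusE /= expr0n expr1n add0r sqrtr1. Qed.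

Lemma modulus_eq0 z : modulus z = 0 -> z = 0.
Proof. exact: ComplexField.Normc.eq0_normc. Qed.

Lemma modulus_gt0 z : z != 0 -> 0 < modulus z.
Proof.
move=> z0; rewrite lt_neqAle modulus_ge0 andbT eq_sym.
by apply: contra z0 => /eqP/modulus_eq0 ->.
Qed.

Lemma normr_Re_le z : `|complex.Re z| <= modulus z.
Proof.
by rewrite modulusE -[leLHS]sqrtr_sqr ler_wsqrtr// lerDl sqr_ge0.
Qed.

Lemma normr_Im_le z : `|complex.Im z| <= modulus z.
Proof.
by rewrite modulusE -[leLHS]sqrtr_sqr ler_wsqrtr// lerDr sqr_ge0.
Qed.

Lemma modulus_le z : modulus z <= `|complex.Re z| + `|complex.Im z|.
Proof.
case: z => a b /=.
have -> : a +i* b = a%:C + 'i * b%:C by congr Complex; rewrite /=; ring.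
by rewrite (le_trans (modulusD _ _))// modulusM modulusi mul1r !modulus_real.
Qed.

Lemma modulus_sqr z :
  modulus z ^+ 2 = complex.Re z ^+ 2 + complex.Im z ^+ 2.
Proof. by rewrite modulusE sqr_sqrtr// addr_ge0 ?sqr_ge0. Qed.

Lemma complexRe_M z w : complex.Re (z * w) =
  complex.Re z * complex.Re w - complex.Im z * complex.Im w.
Proof. by case: z w => [a b] [c d]. Qed.

Lemma complexIm_M z w : complex.Im (z * w) =
  complex.Re z * complex.Im w + complex.Im z * complex.Re w.
Proof. by case: z w => [a b] [c d]. Qed.

Lemma complexRe_D z w : complex.Re (z + w) = complex.Re z + complex.Re w.
Proof. by case: z w => [a b] [c d]. Qed.

Lemma complexIm_D z w : complex.Im (z + w) = complex.Im z + complex.Im w.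
Proof. by case: z w => [a b] [c d]. Qed.

Lemma complexRe_N z : complex.Re (- z) = - complex.Re z.
Proof. by case: z. Qed.

Lemma complexIm_N z : complex.Im (- z) = - complex.Im z.
Proof. by case: z. Qed.

Lemma complexRe_V z : complex.Re z^-1 =
  complex.Re z / (complex.Re z ^+ 2 + complex.Im z ^+ 2).
Proof. by case: z. Qed.

Lemma complexIm_V z : complex.Im z^-1 =
  - complex.Im z / (complex.Re z ^+ 2 + complex.Im z ^+ 2).
Proof. by case: z => a b /=; rewrite mulNr. Qed.

Definition ReIm := (complexRe_M, complexIm_M, complexRe_D, complexIm_D,
  complexRe_N, complexIm_N, complexRe_V, complexIm_V).

Lemma complex_eqP z w :
  complex.Re z = complex.Re w -> complex.Im z = complex.Im w -> z = w.
Proof. by case: z w => [a b] [c d] /= -> ->. Qed.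

Lemma real_complexM x y : (x * y)%:C = x%:C * y%:C :> R[i].
Proof. by apply: complex_eqP; rewrite !ReIm /=; ring. Qed.

Lemma real_complexD x y : (x + y)%:C = x%:C + y%:C :> R[i].
Proof. by apply: complex_eqP; rewrite !ReIm /=; ring. Qed.

Lemma real_complexN x : (- x)%:C = - x%:C :> R[i].
Proof. by apply: complex_eqP; rewrite !ReIm /=; ring. Qed.

Lemma real_complexV x : x^-1%:C = x%:C^-1 :> R[i].
Proof. exact: fmorphV. Qed.

Lemma upper_neq0 z : 0 < complex.Im z -> z != 0.
Proof. by apply: contraTneq => -> /=; rewrite ltxx. Qed.

End complex_basics.

Arguments modulus : simpl never.

Section complex_limits.
Context {R : realType}.
Implicit Types (z w l : R[i]).

Definition ccvg {T : Type} (F : set_system T) (f : T -> R[i]) l : Prop :=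
  complex.Re (f x) @[x --> F] --> complex.Re l /\
  complex.Im (f x) @[x --> F] --> complex.Im l.

Section filter.
Context {T : Type} (F : set_system T) {FF : Filter F}.
Implicit Types f g : T -> R[i].

Lemma ccvg_cst l : ccvg F (fun=> l) l.
Proof. by split; exact: cvg_cst. Qed.

Lemma ccvg_real (f : T -> R) (l : R) :
  f x @[x --> F] --> l -> ccvg F (fun x => (f x)%:C) l%:C.
Proof. by move=> fl; split => //=; exact: cvg_cst. Qed.

Lemma ccvgD f g a b : ccvg F f a -> ccvg F g b ->
  ccvg F (fun x => f x + g x) (a + b).
Proof.
by move=> [f1 f2] [g1 g2]; split; rewrite ReIm;
  under eq_fun do rewrite ReIm; exact: (@cvgD _ R^o).
Qed.

Lemma ccvgN f a : ccvg F f a -> ccvg F (fun x => - f x) (- a).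
Proof.
by move=> [f1 f2]; split; rewrite ReIm;
  under eq_fun do rewrite ReIm; exact: (@cvgN _ R^o).
Qed.

Lemma ccvgM f g a b : ccvg F f a -> ccvg F g b ->
  ccvg F (fun x => f x * g x) (a * b).
Proof.
move=> [f1 f2] [g1 g2]; split; rewrite ReIm;
  under eq_fun do rewrite ReIm.
- by apply: (@cvgB _ R^o); exact: (@cvgM R).
- by apply: (@cvgD _ R^o); exact: (@cvgM R).
Qed.

Lemma modulus_sq_neq0 z : z != 0 ->
  complex.Re z ^+ 2 + complex.Im z ^+ 2 != 0.
Proof.
by move=> z0; rewrite -modulus_sqr expf_neq0// gt_eqF// modulus_gt0.
Qed.

Lemma ccvgV f a : a != 0 -> ccvg F f a -> ccvg F (fun x => (f x)^-1) a^-1.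
Proof.
move=> a0 [f1 f2].
have d : complex.Re (f x) ^+ 2 + complex.Im (f x) ^+ 2 @[x --> F] -->
    complex.Re a ^+ 2 + complex.Im a ^+ 2.
  by under eq_fun do rewrite !expr2; rewrite !expr2;
    apply: (@cvgD _ R^o); exact: (@cvgM R).
split; rewrite ReIm; under eq_fun do rewrite ReIm.
- by apply: cvgM => //; apply: cvgV => //; exact: modulus_sq_neq0.
- apply: cvgM; first exact: (@cvgN _ R^o).
  by apply: cvgV => //; exact: modulus_sq_neq0.
Qed.

Lemma ccvg_near_neq0 f a : a != 0 -> ccvg F f a -> \forall x \near F, f x != 0.
Proof.
move=> a0 [f1 f2].
have d : complex.Re (f x) ^+ 2 + complex.Im (f x) ^+ 2 @[x --> F] -->
    complex.Re a ^+ 2 + complex.Im a ^+ 2.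
  by under eq_fun do rewrite !expr2; rewrite !expr2;
    apply: (@cvgD _ R^o); exact: (@cvgM R).
apply: filterS (@cvgr_neq0 _ R^o _ _ _ _ _ d (modulus_sq_neq0 a0)) => x /=; apply: contraNneq => -> /=.
by rewrite expr0n addr0.
Qed.

Lemma ccvg_near_eq f g a : (\forall x \near F, f x = g x) ->
  ccvg F f a -> ccvg F g a.
Proof.
by move=> fg [f1 f2]; split; [move: f1|move: f2]; apply: cvg_trans;
  apply: near_eq_cvg; apply: filterS fg => x ->.
Qed.

Lemma ccvg_modulus_le f a (e : T -> R) :
  (\forall x \near F, modulus (f x - a) <= e x) -> e x @[x --> F] --> 0 ->
  ccvg F f a.
Proof.
move=> fe e0; split; apply/(@cvgrPdist_le _ R^o) => d d0;
  move/(@cvgrPdist_le _ R^o): e0 => /(_ _ d0); apply: filterS2 fe => x fe;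
  rewrite sub0r normrN => ed.
- rewrite distrC -complexRe_N -complexRe_D (le_trans (normr_Re_le _))//.
  by rewrite (le_trans fe)// (le_trans (ler_norm _)).
- rewrite distrC -complexIm_N -complexIm_D (le_trans (normr_Im_le _))//.
  by rewrite (le_trans fe)// (le_trans (ler_norm _)).
Qed.

Lemma ccvg_modulus f a : ccvg F f a -> modulus (f x) @[x --> F] --> modulus a.
Proof.
move=> [f1 f2]; rewrite modulusE; under eq_fun do rewrite modulusE.
apply: (cvg_comp _ (@Num.sqrt R)); last exact: sqrt_continuous.
by under eq_fun do rewrite !expr2; rewrite !expr2;
  apply: (@cvgD _ R^o); exact: (@cvgM R).
Qed.

End filter.

(** Continuity at [z], tested on all functions converging to [z] along some
    filter: composition is then immediate and no topology on [R[i]] is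
    involved. *)
Definition ccont (f : R[i] -> R[i]) z : Prop :=
  forall (T : Type) (F : set_system T), Filter F ->
    forall g : T -> R[i], ccvg F g z -> ccvg F (f \o g) (f z).

Lemma ccont_cst l z : ccont (fun=> l) z.
Proof. by move=> T F FF g _; exact: ccvg_cst. Qed.

Lemma ccont_id z : ccont id z. Proof. by []. Qed.

Lemma ccontD f g z : ccont f z -> ccont g z -> ccont (fun w => f w + g w) z.
Proof. by move=> cf cg T F FF h hz; apply: ccvgD; [exact: cf|exact: cg]. Qed.

Lemma ccontN f z : ccont f z -> ccont (fun w => - f w) z.
Proof. by move=> cf T F FF h hz; apply: ccvgN; exact: cf. Qed.

Lemma ccontM f g z : ccont f z -> ccont g z -> ccont (fun w => f w * g w) z.
Proof. by move=> cf cg T F FF h hz; apply: ccvgM; [exact: cf|exact: cg]. Qed.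

Lemma ccontV f z : f z != 0 -> ccont f z -> ccont (fun w => (f w)^-1) z.
Proof. by move=> fz cf T F FF h hz; apply: ccvgV => //; exact: cf. Qed.

Lemma ccont_comp f g z : ccont f z -> ccont g (f z) -> ccont (g \o f) z.
Proof. by move=> cf cg T F FF h hz; apply: cg; exact: cf. Qed.

Lemma ccont_bounded_rectangle (f : R[i] -> R[i]) (a b c d : R) :
  (forall z, a <= complex.Re z <= b -> c <= complex.Im z <= d -> ccont f z) ->
  exists C, forall z, a <= complex.Re z <= b -> c <= complex.Im z <= d ->
    modulus (f z) <= C.
Proof.
move=> cf; pose A := `[a, b]%classic `*` `[c, d]%classic.
have [A0|A0] := pselect (A !=set0); last first.
  exists 0 => z zab zcd; exfalso; apply: A0.
  by exists (complex.Re z, complex.Im z); split; rewrite /= in_itv.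
have cA : compact A by apply: compact_setX; exact: segment_compact.
pose phi (p : R * R) : R := modulus (f (p.1 +i* p.2)).
have cphi : {within A, continuous phi}.
  apply: continuous_in_subspaceT => -[x y] /set_mem[/=].
  rewrite !in_itv /= => xab ycd; rewrite /continuous_at /phi.
  have cvf : ccvg (nbhs (x, y)) (fun p : R * R => f (p.1 +i* p.2)) (f (x +i* y)).
    apply: (cf (x +i* y)) => //=.
    by split; [exact: cvg_fst|exact: cvg_snd].
  exact: (ccvg_modulus cvf).
have [p _ pmax] := compact_EVT_max A0 cA cphi.
exists (phi p) => z zab zcd.
have -> : modulus (f z) = phi (complex.Re z, complex.Im z).
  by rewrite /phi; case: z {zab zcd}.
by apply: pmax; rewrite inE; split; rewrite /= in_itv.
Qed.

Lemma ccont_continuous_Re (f : R[i] -> R[i]) (x : R) : ccont f x%:C ->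
  {for x, continuous (fun x : R => complex.Re (f x%:C))}.
Proof.
by move=> cf; have [] := cf _ _ _ (fun x : R => x%:C) (ccvg_real (f := id) (@cvg_id _ (nbhs x))).
Qed.

Lemma ccont_continuous_Im (f : R[i] -> R[i]) (x : R) : ccont f x%:C ->
  {for x, continuous (fun x : R => complex.Im (f x%:C))}.
Proof.
by move=> cf; have [] := cf _ _ _ (fun x : R => x%:C) (ccvg_real (f := id) (@cvg_id _ (nbhs x))).
Qed.

End complex_limits.

Section holomorphy.
Context {R : realType}.
Implicit Types (f g : R[i] -> R[i]) (z w d : R[i]).

(** Caratheodory's form of complex differentiability: the difference quotient
    extends continuously to [z], with value [d]. *)
Definition hol f z d : Prop :=
  exists q : R[i] -> R[i],
    [/\ forall w, f w = f z + q w * (w - z), q z = d & ccont q z].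

Lemma hol_ccont f z d : hol f z d -> ccont f z.
Proof.
move=> [q [fq _ cq]] T F FF g gz.
have -> : f \o g = (fun x => f z + q (g x) * (g x - z)).
  by apply/funext => x /=; rewrite -fq.
have e : f z = f z + q z * (z - z) by rewrite subrr mulr0 addr0.
rewrite [X in ccvg _ _ X]e; apply: ccvgD; first exact: ccvg_cst.
apply: ccvgM; first exact: cq.
by apply: ccvgD => //; exact: ccvg_cst.
Qed.

Lemma hol_cst c z : hol (fun=> c) z 0.
Proof.
by exists (fun=> 0); split => //;
  [move=> w; rewrite mul0r addr0|exact: ccont_cst].
Qed.

Lemma hol_id z : hol id z 1.
Proof.
exists (fun=> 1); split => //; last exact: ccont_cst.
by move=> w; rewrite mul1r addrC subrK.
Qed.

Lemma holD f g z a b : hol f z a -> hol g z b ->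
  hol (fun w => f w + g w) z (a + b).
Proof.
move=> [p [fp pz cp]] [q [gq qz cq]].
exists (fun w => p w + q w); split; [|by rewrite pz qz|exact: ccontD].
by move=> w; rewrite fp gq; ring.
Qed.

Lemma holN f z a : hol f z a -> hol (fun w => - f w) z (- a).
Proof.
move=> [p [fp pz cp]]; exists (fun w => - p w).
by split; [move=> w; rewrite fp; ring|rewrite pz|exact: ccontN].
Qed.

Lemma holM f g z a b : hol f z a -> hol g z b ->
  hol (fun w => f w * g w) z (a * g z + f z * b).
Proof.
move=> hf hg; have cg := hol_ccont hg; move: hf hg.
move=> [p [fp pz cp]] [q [gq qz cq]].
exists (fun w => p w * g w + f z * q w); split; last 2 first.
- by rewrite pz qz.
- apply: ccontD; first exact: ccontM.
  by apply: ccontM => //; exact: ccont_cst.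
- by move=> w; rewrite [in LHS]fp mulrDl [in X in X + _ = _]gq; ring.
Qed.

Lemma holV f z a : f z != 0 -> hol f z a ->
  hol (fun w => (f w)^-1) z (- a / f z ^+ 2).
Proof.
move=> fz hf; have cf := hol_ccont hf; case: hf => [p [fp pz cp]].
exists (fun w => if f w == 0 then - (f z)^-1 / (w - z) else
                 - p w / (f w * f z)); split.
- move=> w; have [fw|fw] := eqVneq (f w) 0.
    rewrite fw invr0 divfK ?subrr// subr_eq0.
    by apply: contraNneq fz => <-; rewrite fw.
  have e : p w * (w - z) = f w - f z by rewrite [in RHS]fp; ring.
  rewrite mulrAC mulNr e; field.
  by rewrite fz fw.
- by rewrite (negbTE fz) pz expr2.
- move=> T F FF g gz; rewrite (negbTE fz).
  have fgz := cf _ _ FF _ gz.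
  apply: (@ccvg_near_eq _ _ _ _ (fun x => - p (g x) / (f (g x) * f z))).
    by apply: filterS (ccvg_near_neq0 fz fgz) => x /= /negbTE ->.
  apply: ccvgM; first by apply: ccvgN; exact: cp.
  apply: ccvgV; first by rewrite mulf_neq0.
  by apply: ccvgM => //; exact: ccvg_cst.
Qed.

Lemma hol_comp f g z a b : hol f z a -> hol g (f z) b ->
  hol (g \o f) z (b * a).
Proof.
move=> hf; have cf := hol_ccont hf; case: hf => [p [fp pz cp]].
move=> [q [gq qz cq]].
exists (fun w => q (f w) * p w); split; [|by rewrite pz qz|].
- move=> w /=; rewrite gq; congr (_ + _); rewrite -mulrA; congr (_ * _).
  by rewrite [in LHS]fp; ring.
- by apply: ccontM => //; exact: (ccont_comp cf cq).
Qed.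

Lemma holZ (k : R[i]) f z a : hol f z a -> hol (fun w => k * f w) z (k * a).
Proof.
by move=> hf; have := holM (hol_cst k z) hf; rewrite mul0r add0r.
Qed.

Lemma hol_der_eq f z a b : a = b -> hol f z a -> hol f z b.
Proof. by move=> ->. Qed.

Lemma hol_is_derive_Re f (s : R) d : hol f s%:C d ->
  is_derive s 1 (fun t : R => complex.Re (f t%:C)) (complex.Re d).
Proof.
move=> [q [fq qz cq]].
have H : (fun h : R => h^-1 *: (complex.Re (f (h *: (1 : R^o) + s)%:C) -
    complex.Re (f s%:C))) @ 0^' --> complex.Re d.
  have q1 : complex.Re (q (h *: (1 : R^o) + s)%:C) @[h --> 0^'] --> complex.Re d.
    suff : ccvg 0^' (q \o (fun h : R => (h *: (1 : R^o) + s)%:C)) (q s%:C).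
      by rewrite qz => -[].
    apply: cq; apply: ccvg_real.
    rewrite -[X in _ --> X]add0r -[X in X + _](mulr0 1) mulrC.
    apply: (@cvgD _ R^o); last exact: cvg_cst.
    apply: (@cvgM R); last exact: cvg_cst.
    exact: nbhs_dnbhs.
  apply: cvg_trans q1; apply: near_eq_cvg.
  near=> h; have h0 : h != 0 by near: h; exact: nbhs_dnbhs_neq.
  rewrite [in RHS]fq complexRe_D addrAC subrr add0r.
  have -> : (h *: (1 : R^o) + s)%:C - s%:C = h%:C.
    by apply: complex_eqP; rewrite /= ?subrr// /GRing.scale /=; ring.
  by rewrite complexRe_M /= mulr0 subr0 /GRing.scale /= mulrCA mulVf ?mulr1.
apply: DeriveDef.
  by apply/cvg_ex; exists (complex.Re d).
exact/cvg_lim.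
Unshelve. all: by end_near. Qed.

Lemma hol_is_derive_Im f (s : R) d : hol f s%:C d ->
  is_derive s 1 (fun t : R => complex.Im (f t%:C)) (complex.Im d).
Proof.
move=> /(holZ (- 'i))/hol_is_derive_Re.
have e z : complex.Re (- 'i * z) = complex.Im z.
  by case: z => a b; simpc; rewrite /= ?mul0r ?mul1r ?oppr0; ring.
by under eq_fun do rewrite e; rewrite e.
Qed.

End holomorphy.

(** * Integrals over unbounded intervals and the Poisson kernel *)

Section real_integrals.
Context {R : realType}.
Notation mu := (@lebesgue_measure R).

Lemma dominated_integrable (D : set R) (f g : R -> R) : measurable D ->
  measurable_fun D f -> (forall x, D x -> `|f x| <= g x) ->
  mu.-integrable D (EFin \o g) -> mu.-integrable D (EFin \o f).
Proof.
move=> mD mf fg.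
apply: (@le_integrable _ _ _ mu D mD (EFin \o f) (EFin \o g)).
  exact/measurable_EFinP.
by move=> x Dx /=; rewrite lee_fin (le_trans (fg x Dx))// ler_norm.
Qed.

Lemma integrable_mull (D : set R) (k : R) (f : R -> R) : measurable D ->
  mu.-integrable D (EFin \o f) -> mu.-integrable D (EFin \o (fun x => k * f x)).
Proof.
move=> mD intf.
rewrite (_ : _ \o _ = fun x => (k%:E * (EFin \o f) x)%E); first exact: integrableZl.
by apply/funext => x; rewrite /= EFinM.
Qed.

Lemma integrable_add (D : set R) (f g : R -> R) : measurable D ->
  mu.-integrable D (EFin \o f) -> mu.-integrable D (EFin \o g) ->
  mu.-integrable D (EFin \o (fun x => f x + g x)).
Proof.
move=> mD intf intg.
rewrite (_ : _ \o _ = ((EFin \o f) \+ (EFin \o g))%E); first exact: integrableD.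
by apply/funext => x; rewrite /= EFinD.
Qed.

Lemma dominated_cvg_Rintegral (D : set R) (f_ : nat -> R -> R) (f g : R -> R) :
  measurable D -> (forall n, measurable_fun D (f_ n)) ->
  (forall x, D x -> f_ n x @[n --> \oo] --> f x) ->
  mu.-integrable D (EFin \o g) ->
  (forall n x, D x -> `|f_ n x| <= g x) ->
  \int[mu]_(x in D) f_ n x @[n --> \oo] --> \int[mu]_(x in D) f x.
Proof.
move=> mD mf cf ig fg; apply: fine_cvg.
have mf' : measurable_fun D f by apply: measurable_fun_cvg cf => n; exact: mf.
rewrite fineK; last first.
  apply: integrable_fin_num => //.
  apply: (dominated_integrable mD mf' _ ig) => x Dx.
  apply: (@closed_cvg _ _ \oo _ (fun n => `|f_ n x|) (fun y => y <= g x)).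
  - exact: closed_le.
  - by apply: nearW => n; exact: fg.
  - by apply: cvg_norm; exact: cf.
apply: (@dominated_cvg _ _ _ mu _ _ (fun n x => (f_ n x)%:E) _ (EFin \o g)) => //.
- by move=> n; apply/measurable_EFinP; exact: mf.
- by move=> x Dx; apply: cvg_EFin; [exact: nearW|exact: cf].
Qed.

Lemma FTC_exhaustion (D : set R) (f F : R -> R) (a_ b_ : nat -> R) (l : R) :
  measurable D -> continuous f -> mu.-integrable D (EFin \o f) ->
  (forall x : R, is_derive x 1 F (f x)) ->
  (forall n, a_ n < b_ n) ->
  (forall n, `[a_ n, b_ n]%classic `<=` D) ->
  (forall x, D x -> \forall n \near \oo, a_ n <= x <= b_ n) ->
  F (b_ n) - F (a_ n) @[n --> \oo] --> l ->
  \int[mu]_(x in D) f x = l.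
Proof.
move=> mD cf intf dF ab abD Dab Fl.
have dF' x : derivable F x 1 by case: (dF x).
have H : F (b_ n) - F (a_ n) @[n --> \oo] --> \int[mu]_(x in D) f x.
  have -> : (fun n => F (b_ n) - F (a_ n)) =
      (fun n => \int[mu]_(x in D) (f \_ `[a_ n, b_ n]) x).
    apply/funext => n; rewrite -Rintegral_mkcondr setIidr//.
    rewrite /Rintegral (@continuous_FTC2 _ f F)//.
    + exact: continuous_subspaceT.
    + split => //.
      * apply: cvg_at_right_filter; apply: differentiable_continuous.
        exact/derivable1_diffP.
      * apply: cvg_at_left_filter; apply: differentiable_continuous.
        exact/derivable1_diffP.
    + by move=> x _; rewrite derive1E; case: (dF x).
  apply: (@dominated_cvg_Rintegral _ _ _ (fun x => `|f x|)) => //.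
  - move=> n; apply: measurable_funTS; apply/(measurable_restrictT f) => //.
    by apply: measurable_funTS; exact: continuous_measurable_fun.
  - move=> x Dx; apply: cvg_near_cst.
    apply: filterS (Dab x Dx) => n abx; rewrite patchE.
    by rewrite ifT// inE /= in_itv.
  - exact: (integrable_norm intf).
  - by move=> n x Dx; rewrite patchE; case: ifPn => // _; rewrite normr0.
exact: (cvg_unique _ H Fl).
Qed.

Lemma FTC_line (f F : R -> R) (l l' : R) :
  continuous f -> mu.-integrable setT (EFin \o f) ->
  (forall x : R, is_derive x 1 F (f x)) ->
  F x @[x --> +oo] --> l -> F x @[x --> -oo] --> l' ->
  \int[mu]_x f x = l - l'.
Proof.
move=> cf intf dF Fl Fl'.
apply: (@FTC_exhaustion _ f F (fun n => - n.+1%:R) (fun n => n.+1%:R)) => //.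
- by move=> n; rewrite (@lt_trans _ _ 0)// oppr_lt0.
- move=> x _; near=> n.
  have nx : `|x| <= n.+1%:R.
    apply/ltW; apply: (@lt_le_trans _ _ n%:R); last by rewrite ler_nat.
    near: n; exact: nbhs_infty_gtr.
  by move: nx; rewrite ler_norml.
- apply: (@cvgB _ R^o).
  + by apply: (cvg_comp _ F _ Fl); apply/cvgryPge => A;
      apply: filterS (nbhs_infty_ger A) => n An; rewrite (le_trans An)// ler_nat.
  + apply: (cvg_comp _ F _ Fl'); apply/cvgrNyPle => A.
    apply: filterS (nbhs_infty_ger (- A)) => n An.
    by rewrite lerNl (le_trans An)// ler_nat.
Unshelve. all: by end_near. Qed.

Lemma FTC_half_line (f F : R -> R) (l : R) :
  continuous f -> mu.-integrable `[0, +oo[ (EFin \o f) ->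
  (forall x : R, is_derive x 1 F (f x)) ->
  F x @[x --> +oo] --> l ->
  \int[mu]_(x in `[0, +oo[) f x = l - F 0.
Proof.
move=> cf intf dF Fl.
apply: (@FTC_exhaustion _ f F (fun=> 0) (fun n => n.+1%:R)) => //.
- by move=> n x /=; rewrite !in_itv /= => /andP[->].
- move=> x /=; rewrite in_itv /= andbT => x0; near=> n.
  rewrite x0/= ltW//; apply: (@lt_le_trans _ _ n%:R); last by rewrite ler_nat.
  near: n; exact: nbhs_infty_gtr.
- apply: (@cvgB _ R^o); last exact: cvg_cst.
  by apply: (cvg_comp _ F _ Fl); apply/cvgryPge => A;
    apply: filterS (nbhs_infty_ger A) => n An; rewrite (le_trans An)// ler_nat.
Unshelve. all: by end_near. Qed.

Definition poisson_kernel (a b x : R) : R := b / ((x - a) ^+ 2 + b ^+ 2).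

Lemma poisson_kernel_ge0 a b x : 0 <= b -> 0 <= poisson_kernel a b x.
Proof. by move=> b0; rewrite divr_ge0// addr_ge0 ?sqr_ge0. Qed.

Lemma poisson_kernel_gt0 a b x : 0 < b -> 0 < poisson_kernel a b x.
Proof.
by move=> b0; rewrite divr_gt0// ltr_wpDl ?sqr_ge0 ?exprn_gt0.
Qed.

Lemma continuous_poisson_kernel a b : 0 < b -> continuous (poisson_kernel a b).
Proof.
move=> b0 x; apply: (@cvgM R); first exact: cvg_cst.
apply: cvgV; first by rewrite gt_eqF// ltr_wpDl ?sqr_ge0 ?exprn_gt0.
apply: (@cvgD _ R^o); last exact: cvg_cst.
rewrite expr2; under eq_fun do rewrite expr2.
by apply: (@cvgM R); apply: (@cvgB _ R^o) => //; exact: cvg_cst.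
Qed.

Lemma is_derive_atan_poisson (a b x : R) : 0 < b ->
  is_derive x 1 (fun x => atan ((x - a) / b)) (poisson_kernel a b x).
Proof.
move=> b0; have b0' : b != 0 by rewrite gt_eqF.
have d : is_derive x (1 : R) (fun x : R => (x - a) / b) b^-1.
  by apply: is_derive_eq; rewrite /GRing.scale /=; ring.
have := @is_derive1_comp _ atan (fun x : R => (x - a) / b) x _ _
  (is_derive1_atan ((x - a) / b)) d.
move=> /is_derive_eq; apply; rewrite /poisson_kernel; field.
by rewrite b0' andbT gt_eqF// ltr_wpDl ?sqr_ge0 ?exprn_gt0.
Qed.

Lemma atan_line_cvgy (a b : R) : 0 < b ->
  atan ((x - a) / b) @[x --> (+oo : set_system R)] --> pi / 2.
Proof.
move=> b0; apply: (cvg_comp _ atan); last exact: cvgy_atan.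
apply: gt0_cvgMly; first by rewrite invr_gt0.
exact: (@cvg_addrr R (- a)).
Qed.

Lemma atan_line_cvgNy (a b : R) : 0 < b ->
  atan ((x - a) / b) @[x --> (-oo : set_system R)] --> - (pi / 2).
Proof.
move=> b0.
have -> : (fun x : R => atan ((x - a) / b)) =
    (fun x => - atan ((- x - (- a)) / b)).
  by apply/funext => x; rewrite -atanN -mulNr opprB opprK addrC.
apply: (@cvgN _ R^o).
apply: (cvg_comp -%R (fun x => atan ((x - - a) / b))); last exact: atan_line_cvgy.
by apply/(cvgNry (fun x : R => x)); exact: cvg_id.
Qed.

Lemma integral_poisson_kernel (a b : R) : 0 < b ->
  (\int[mu]_x (poisson_kernel a b x)%:E = pi%:E)%E.
Proof.
move=> b0; pose F x := atan ((x - a) / b).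
have dF x := is_derive_atan_poisson a x b0.
pose I (n : nat) : set R := `[- n.+1%:R, n.+1%:R]%classic.
have H := @ge0_nondecreasing_set_cvg_integral _ (measurableTypeR R) R
  I (EFin \o poisson_kernel a b) mu.
have mP : measurable_fun setT (poisson_kernel a b).
  by apply: continuous_measurable_fun; exact: continuous_poisson_kernel.
have {}H : (\int[mu]_(x in I n) (poisson_kernel a b x)%:E
    @[n --> \oo] --> \int[mu]_x (poisson_kernel a b x)%:E)%E.
  have -> : [set: R] = \bigcup_n I n.
    apply/esym; rewrite -subTset => x _.
    exists (Num.trunc `|x|) => //; rewrite /I /= in_itv /= -ler_norml ltW//.
    exact: truncnS_gt.
  apply: H.
  - move=> m n mn; apply/subsetPset => x; rewrite /I /= !in_itv /= -!ler_norml.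
    by move=> h; rewrite (le_trans h)// ler_nat.
  - by move=> n; exact: measurable_itv.
  - by move=> n; apply/measurable_EFinP; exact: measurable_funTS.
  - by move=> n x _; rewrite lee_fin poisson_kernel_ge0// ltW.
have dF' (x : R) : derivable F x 1 by case: (dF x).
have E n : (\int[mu]_(x in I n) (poisson_kernel a b x)%:E =
    (F n.+1%:R - F (- n.+1%:R))%:E)%E.
  rewrite (@continuous_FTC2 _ _ F) ?EFinB//.
  - by rewrite (@lt_trans _ _ 0)// oppr_lt0.
  - by apply: continuous_subspaceT; exact: continuous_poisson_kernel.
  - split => //.
    + apply: cvg_at_right_filter; apply: differentiable_continuous.
      exact/derivable1_diffP.
    + apply: cvg_at_left_filter; apply: differentiable_continuous.
      exact/derivable1_diffP.
  - by move=> x _; rewrite derive1E; case: (dF x).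
have G : ((F n.+1%:R - F (- n.+1%:R))%:E @[n --> \oo] --> (pi : R)%:E)%E.
  apply: cvg_EFin; first exact: nearW.
  have -> : pi = pi / 2 - (- (pi / 2)) :> R by field.
  apply: (@cvgB _ R^o).
  + apply: (cvg_comp _ F _ (atan_line_cvgy a b0)); apply/cvgryPge => A;
    by apply: filterS (nbhs_infty_ger A) => n An; rewrite (le_trans An)// ler_nat.
  + apply: (cvg_comp _ F _ (atan_line_cvgNy a b0)); apply/cvgrNyPle => A.
    apply: filterS (nbhs_infty_ger (- A)) => n An.
    by rewrite lerNl (le_trans An)// ler_nat.
move: H; under eq_fun do rewrite E.
by move=> H; exact: (cvg_unique _ H G).
Qed.

Lemma integrable_poisson_kernel a b : 0 < b ->
  mu.-integrable setT (EFin \o poisson_kernel a b).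
Proof.
move=> b0; apply/integrableP; split.
  apply/measurable_EFinP; apply: continuous_measurable_fun.
  exact: continuous_poisson_kernel.
under eq_integral => x _.
  rewrite /= ger0_norm; last by rewrite poisson_kernel_ge0// ltW.
  over.
by rewrite integral_poisson_kernel// ltry.
Qed.

Lemma Rintegral_poisson_kernel a b : 0 < b ->
  \int[mu]_x poisson_kernel a b x = pi.
Proof. by move=> b0; rewrite /Rintegral integral_poisson_kernel. Qed.

Lemma integrable_bounded_poisson (g : R -> R) a b C : 0 < b ->
  measurable_fun setT g -> (forall x, `|g x| <= C * poisson_kernel a b x) ->
  mu.-integrable setT (EFin \o g).
Proof.
move=> b0 mg gC; have iP := integrable_poisson_kernel a b0.
apply: (dominated_integrable _ mg (fun x _ => gC x)) => //.
exact: integrable_mull.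
Qed.

(** Exponential polynomials against the Gaussian weight: as [t <= expR t] on
    the half-line, completing the square dominates them by a shifted Gaussian. *)
Lemma integrable_gaussian_moment (m : nat) (a : R) :
  mu.-integrable `[0, +oo[ (EFin \o (fun t => t ^+ m * expR (a * t - t ^+ 2 / 2))).
Proof.
pose b := a + m%:R.
pose K := (normal_peak (1 : R))^-1 * expR (b ^+ 2 / 2).
apply: (@dominated_integrable _ _ (fun t => K * normal_pdf b 1 t)) => //.
- apply: measurable_funTS.
  apply: continuous_measurable_fun => x.
  apply: (@cvgM R); first exact: exprn_continuous.
  apply: (cvg_comp _ expR); last exact: continuous_expR.
  apply: (@cvgB _ R^o); first by apply: (@cvgM R) => //; exact: cvg_cst.
  apply: (@cvgM R); last exact: cvg_cst.
  exact: exprn_continuous.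
- move=> t; rewrite /= in_itv /= andbT => t0.
  rewrite ger0_norm ?mulr_ge0 ?exprn_ge0 ?expR_ge0//.
  rewrite normal_pdfE ?oner_neq0//.
  have p0 : normal_peak (1 : R) != 0 by rewrite gt_eqF// normal_peak_gt0 ?oner_neq0.
  rewrite (_ : K * _ = expR (b ^+ 2 / 2) * normal_fun b 1 t); last first.
    by rewrite /K; field.
  rewrite /normal_fun -expRD.
  apply: (@le_trans _ _ (expR (m%:R * t) * expR (a * t - t ^+ 2 / 2))).
    rewrite ler_wpM2r ?expR_ge0// expRM_natl lerXn2r ?nnegrE ?expR_ge0//.
    by rewrite (le_trans _ (expR_ge1Dx t))// lerDr.
  by rewrite -expRD ler_expR /b expr1n; lra.
- have i1 := integrable_normal_pdf b (1 : R).
  have i2 : mu.-integrable `[0, +oo[ (fun t => (normal_pdf b 1 t)%:E).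
    by apply: integrableS i1.
  exact: integrable_mull.
Qed.

End real_integrals.

(** * A conformal flow contracting the line to a point *)

Section poisson_formula.
Context {R : realType}.
Notation mu := (@lebesgue_measure R).
Variables (a b : R).
Hypothesis b0 : 0 < b.

(** [a + b tan (atan ((x - a) / b) + i artanh s)], written as a rational
    function. As the real time [s] runs from 0 to 1, the image of the real
    line in [x] shrinks from the line itself to the point [a + i b], through
    the hyperbolic circles centred there. *)
Definition conformal_flow (s x : R[i]) : R[i] :=
  a%:C + b%:C * ((x - a%:C) + 'i * b%:C * s) / (b%:C - 'i * s * (x - a%:C)).

Local Notation w := conformal_flow.
Local Notation den s x := (b%:C - 'i * s%:C * (x%:C - a%:C)).

Let Re_den (s x : R) : complex.Re (den s x) = b.
Proof. by rewrite !ReIm /=; ring. Qed.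

Let Im_den (s x : R) : complex.Im (den s x) = - (s * (x - a)).
Proof. by rewrite !ReIm /=; ring. Qed.

Lemma flow_denominator_neq0 (s x : R) : den s x != 0.
Proof.
apply/eqP => /(congr1 (@complex.Re R)); rewrite Re_den /= => /eqP.
by rewrite gt_eqF.
Qed.

Lemma modulus_flow_denominator (s x : R) : modulus (den s x) ^+ 2 = b ^+ 2 + s ^+ 2 * (x - a) ^+ 2.
Proof. by rewrite modulus_sqr Re_den Im_den sqrrN exprMn. Qed.

Lemma flow_denominator_gt0 (s x : R) : 0 < b ^+ 2 + s ^+ 2 * (x - a) ^+ 2.
Proof. by rewrite ltr_wpDr ?exprn_gt0// mulr_ge0 ?sqr_ge0. Qed.

Lemma Re_conformal_flow (s x : R) : complex.Re (w s%:C x%:C) =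
  a + b ^+ 2 * (1 - s ^+ 2) * (x - a) / (b ^+ 2 + s ^+ 2 * (x - a) ^+ 2).
Proof.
have h := flow_denominator_gt0 s x.
rewrite /w complexRe_D complexRe_M complexRe_V complexIm_V Re_den Im_den.
rewrite !ReIm /=; field.
by rewrite exprMn gt_eqF.
Qed.

Lemma Im_conformal_flow (s x : R) : complex.Im (w s%:C x%:C) =
  b * s * ((x - a) ^+ 2 + b ^+ 2) / (b ^+ 2 + s ^+ 2 * (x - a) ^+ 2).
Proof.
have h := flow_denominator_gt0 s x.
rewrite /w complexIm_D complexIm_M complexRe_V complexIm_V Re_den Im_den.
rewrite !ReIm /=; field.
by rewrite exprMn gt_eqF.
Qed.

Lemma Im_conformal_flow_gt0 (s x : R) : 0 < s -> 0 < complex.Im (w s%:C x%:C).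
Proof.
move=> s0; rewrite Im_conformal_flow divr_gt0 ?flow_denominator_gt0// !mulr_gt0//.
by rewrite ltr_wpDl ?sqr_ge0 ?exprn_gt0.
Qed.

(** For [s] bounded away from 0 the circles stay in a compact part of the
    open half-plane, where derivatives are bounded. *)
Lemma conformal_flow_rectangle (u s x : R) : 0 < u -> u < s -> s < 1 ->
  a - b / u <= complex.Re (w s%:C x%:C) <= a + b / u /\
  b * u <= complex.Im (w s%:C x%:C) <= b / u.
Proof.
move=> u0 us s1; have h := flow_denominator_gt0 s x.
have s0 : 0 < s by exact: lt_trans us.
have bsu : b / s <= b / u by rewrite ler_pM2l// lef_pV2 ?posrE// ltW.
split.
  rewrite Re_conformal_flow lerD2l -[- _ <= _]lerN2 opprK andbC.
  apply/andP.
  have : `|b ^+ 2 * (1 - s ^+ 2) * (x - a) / (b ^+ 2 + s ^+ 2 * (x - a) ^+ 2)|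
     <= b / s.
    rewrite normrM normfV (gtr0_norm h) ler_pdivrMr// [leRHS]mulrAC ler_pdivlMr//.
    rewrite 2!normrM (ger0_norm (sqr_ge0 b)) (@ger0_norm _ (1 - s ^+ 2)); last first.
      by rewrite subr_ge0 expr_le1// ltW.
    apply: (@le_trans _ _ (b ^+ 2 * 1 * `|x - a| * s)).
      apply: ler_wpM2r; first exact: ltW.
      apply: ler_wpM2r => //; apply: ler_wpM2l; first exact: sqr_ge0.
      by rewrite gerBl sqr_ge0.
    rewrite mulr1 expr2 -!mulrA ler_pM2l//.
    rewrite -(real_normK (num_real (x - a))).
    have := mulr_ge0 (ltW b0) (mulr_ge0 (ltW s0) (normr_ge0 (x - a))).
    have := sqr_ge0 (b - s * `|x - a|).
    by move: `|x - a| => y; rewrite sqrrB; lra.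
  move=> hh; have := le_trans hh bsu; rewrite ler_norml => /andP[h1 h2].
  by split; lra.
rewrite Im_conformal_flow; apply/andP; split.
  rewrite ler_pdivlMr// -2!mulrA ler_pM2l//.
  apply: ler_pM; [exact: ltW|exact: ltW|exact: ltW|].
  rewrite addrC lerD2r; apply: ler_piMl; rewrite ?sqr_ge0//.
  by rewrite expr_le1// ltW.
apply: le_trans bsu.
rewrite ler_pdivrMr// [leRHS]mulrAC ler_pdivlMr// -!mulrA ler_pM2l//.
have : 0 <= (1 - s ^+ 2) * b ^+ 2 by rewrite mulr_ge0 ?sqr_ge0// subr_ge0 expr_le1// ltW.
lra.
Qed.

Lemma conformal_flow0 (x : R) : w 0%:C x%:C = x%:C.
Proof.
apply: complex_eqP; rewrite ?Re_conformal_flow ?Im_conformal_flow /=.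
- by rewrite expr0n mul0r addr0 subr0 mulr1; field; rewrite gt_eqF.
- by rewrite mulr0 !mul0r.
Qed.

Lemma conformal_flow1 (x : R) : w 1%:C x%:C = a +i* b.
Proof.
have h := flow_denominator_gt0 1 x.
apply: complex_eqP; rewrite ?Re_conformal_flow ?Im_conformal_flow /=.
- by rewrite expr1n subrr mulr0 !mul0r addr0.
- by move: h; rewrite expr1n !mul1r mulr1 addrC => h; rewrite mulfK ?gt_eqF.
Qed.

(** The two derivatives below satisfy
    [poisson_kernel a b x * dw/ds = i / (1 - s ^+ 2) * dw/dx]: the flow is
    conformal in [atan + i artanh]. *)
Lemma hol_conformal_flow_time (s x : R) :
  hol (fun s => w s x%:C) s%:C
    ('i * b%:C * (b ^+ 2 + (x - a) ^+ 2)%:C / den s x ^+ 2).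
Proof.
have ii : 'i * 'i = - 1 :> R[i] by rewrite -expr2 sqr_i.
have d0 := flow_denominator_neq0 s x.
pose X := x%:C - a%:C : R[i].
have hn : hol (fun s => b%:C * (X + 'i * b%:C * s)) s%:C
    (b%:C * (0 + 'i * b%:C * 1)).
  by apply: holZ; apply: holD; [exact: hol_cst|apply: holZ; exact: hol_id].
have hd : hol (fun s => b%:C - 'i * s * X) s%:C
    (0 - (('i * 1) * X + ('i * s%:C) * 0)).
  apply: holD; first exact: hol_cst.
  apply: holN; apply: (@holM _ (fun s => 'i * s) (fun=> X)); last exact: hol_cst.
  by apply: holZ; exact: hol_id.
have := holD (hol_cst a%:C s%:C)
  (holM hn (@holV _ (fun s => b%:C - 'i * s * X) _ _ d0 hd)).
apply: hol_der_eq.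
have XE : X = (x - a)%:C by rewrite /X rmorphB.
rewrite -/X rmorphD !rmorphXn /= -XE; field: ii.
by rewrite d0.
Qed.

Lemma hol_conformal_flow_space (s x : R) :
  hol (fun x => w s%:C x) x%:C
    (b%:C ^+ 2 * (1 - s%:C ^+ 2) / den s x ^+ 2).
Proof.
have ii : 'i * 'i = - 1 :> R[i] by rewrite -expr2 sqr_i.
have d0 := flow_denominator_neq0 s x.
have hX : hol (fun x => x - a%:C) x%:C 1.
  by have := holD (hol_id x%:C) (hol_cst (- a%:C) x%:C); rewrite addr0.
have hn : hol (fun x => b%:C * (x - a%:C + 'i * b%:C * s%:C)) x%:C
    (b%:C * (1 + 0)).
  by apply: holZ; apply: holD => //; exact: hol_cst.
have hd : hol (fun x => b%:C - 'i * s%:C * (x - a%:C)) x%:C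
    (0 - 'i * s%:C * 1).
  by apply: holD; [exact: hol_cst|apply: holN; exact: holZ].
have := holD (hol_cst a%:C x%:C)
  (holM hn (@holV _ (fun x => b%:C - 'i * s%:C * (x - a%:C)) _ _ d0 hd)).
apply: hol_der_eq; field: ii.
by rewrite d0.
Qed.

End poisson_formula.

(** * Poisson's formula *)

Section poisson_formula.
Context {R : realType}.
Notation mu := (@lebesgue_measure R).
Variables (a b : R).
Hypothesis b0 : 0 < b.
Variables (h h' : R[i] -> R[i]) (B : R).
Hypothesis hol_h : forall z : R[i], 0 < complex.Im z -> hol h z (h' z).
Hypothesis cont_h' : forall z : R[i], 0 < complex.Im z -> ccont h' z.
Hypothesis cont_h : forall x : R, ccont h x%:C.
Hypothesis bound_h : forall z : R[i], 0 <= complex.Im z -> modulus (h z) <= B.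

Local Notation w := (conformal_flow a b).
Local Notation den s x := (b%:C - 'i * s%:C * (x%:C - a%:C)).

Let integrand (s x : R) : R :=
  poisson_kernel a b x * complex.Re (h (w s%:C x%:C)).

Let derivand (s x : R) : R :=
  complex.Re (h' (w s%:C x%:C) * ('i * b%:C ^+ 2 / den s x ^+ 2)).

Let b0' : b != 0. Proof. by rewrite gt_eqF. Qed.

Let derive_time (s x : R) : 0 < s ->
  is_derive s 1 (integrand ^~ x) (derivand s x).
Proof.
move=> s0; have up := Im_conformal_flow_gt0 a b0 x s0.
have H := hol_comp (hol_conformal_flow_time a b0 s x) (hol_h up).
have := hol_is_derive_Re (holZ (poisson_kernel a b x)%:C H).
have -> : (fun t : R => complex.Re ((poisson_kernel a b x)%:C *
    (h \o (fun s => w s x%:C)) t%:C)) = integrand ^~ x.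
  by apply/funext => t /=; rewrite complexRe_M /= mul0r subr0.
move=> /is_derive_eq; apply; rewrite /derivand; congr complex.Re.
rewrite mulrCA; congr (_ * _); rewrite [LHS]mulrA; congr (_ / _).
have n0 : (x - a) ^+ 2 + b ^+ 2 != 0.
  by rewrite gt_eqF// ltr_wpDl ?sqr_ge0 ?exprn_gt0.
have -> : (poisson_kernel a b x)%:C * ('i * b%:C * (b ^+ 2 + (x - a) ^+ 2)%:C) =
  'i * b%:C * (poisson_kernel a b x * (b ^+ 2 + (x - a) ^+ 2))%:C.
  by rewrite real_complexM; ring.
by rewrite /poisson_kernel (addrC (b ^+ 2)) divfK// expr2 mulrA.
Qed.

(** By conformality the time derivative above is, at fixed [s], also an
    [x]-derivative. *)
Let derive_space (s x : R) : 0 < s -> s < 1 ->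
  is_derive x 1
    (fun x => complex.Re ('i * (1 - s ^+ 2)^-1%:C * h (w s%:C x%:C)))
    (derivand s x).
Proof.
move=> s0 s1; have up := Im_conformal_flow_gt0 a b0 x s0.
have H := hol_comp (hol_conformal_flow_space a b0 s x) (hol_h up).
have := hol_is_derive_Re (holZ ('i * (1 - s ^+ 2)^-1%:C) H).
move=> /is_derive_eq; apply; rewrite /derivand; congr complex.Re.
rewrite mulrCA; congr (_ * _); rewrite [LHS]mulrA; congr (_ / _).
have n0 : 1 - s ^+ 2 != 0 by rewrite gt_eqF// subr_gt0 expr_lt1// ltW.
have kk : (1 - s ^+ 2)^-1%:C * (1 - s%:C ^+ 2) = 1 :> R[i].
  have -> : 1 - s%:C ^+ 2 = (1 - s ^+ 2)%:C :> R[i].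
    by rewrite real_complexD real_complexN !expr2 real_complexM.
  by rewrite -real_complexM mulVf.
have -> : 'i * (1 - s ^+ 2)^-1%:C * (b%:C ^+ 2 * (1 - s%:C ^+ 2)) =
  'i * b%:C ^+ 2 * ((1 - s ^+ 2)^-1%:C * (1 - s%:C ^+ 2)) :> R[i] by ring.
by rewrite kk mulr1.
Qed.

Let derivand_bound (u : R) : 0 < u -> exists C, forall s x, u < s -> s < 1 ->
  `|derivand s x| <= C * poisson_kernel a (b / u) x.
Proof.
move=> u0.
have [z _ /andP[bu _]|C HC] :=
    @ccont_bounded_rectangle _ h' (a - b / u) (a + b / u) (b * u) (b / u).
  by apply: cont_h'; rewrite (lt_le_trans _ bu)// mulr_gt0.
exists (C * (b / u)) => s x us s1.
have [wRe wIm] := conformal_flow_rectangle a b0 x u0 us s1.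
have {}HC := HC _ wRe wIm.
have nd := modulus_flow_denominator a b s x.
have nd0 := flow_denominator_gt0 a b0 s x.
rewrite (le_trans (normr_Re_le _))// modulusM -[leRHS]mulrA.
apply: ler_pM; rewrite ?modulus_ge0//.
rewrite 2!modulusM modulusi mul1r modulusV !modulusX nd modulus_real.
rewrite gtr0_norm//.
have -> : b / u * poisson_kernel a (b / u) x =
    b ^+ 2 / (b ^+ 2 + u ^+ 2 * (x - a) ^+ 2).
  have n2 := flow_denominator_gt0 a b0 u x.
  rewrite /poisson_kernel; field.
  by rewrite (gt_eqF u0) andbT exprMn gt_eqF.
rewrite ler_pM2l ?exprn_gt0// lef_pV2 ?posrE ?flow_denominator_gt0//.
rewrite lerD2l ler_wpM2r ?sqr_ge0// lerXn2r ?nnegrE ?ltW//.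
exact: lt_trans us.
Qed.

Let continuous_derivand s : 0 < s -> continuous (derivand s).
Proof.
move=> s0 x.
apply: (@ccont_continuous_Re _ (fun x => h' (w s%:C x) *
  ('i * b%:C ^+ 2 / (b%:C - 'i * s%:C * (x - a%:C)) ^+ 2))).
have up := Im_conformal_flow_gt0 a b0 x s0.
have d0 := flow_denominator_neq0 a b0 s x.
have cw := hol_ccont (hol_conformal_flow_space a b0 s x).
apply: ccontM; first exact: (ccont_comp cw (cont_h' up)).
apply: ccontM; first exact: ccont_cst.
apply: (@ccontV _ (fun x => (b%:C - 'i * s%:C * (x - a%:C)) ^+ 2)).
  by rewrite expf_neq0.
have cd : ccont (fun x => b%:C - 'i * s%:C * (x - a%:C)) x%:C.
  apply: ccontD; first exact: ccont_cst.
  apply: ccontN; apply: ccontM; first exact: ccont_cst.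
  by apply: ccontD; [exact: ccont_id|exact: ccont_cst].
exact: (ccontM cd cd).
Qed.

Let continuous_integrand s : 0 < s -> continuous (integrand s).
Proof.
move=> s0 x; apply: (@cvgM R); first exact: continuous_poisson_kernel.
have up := Im_conformal_flow_gt0 a b0 x s0.
have cw := hol_ccont (hol_conformal_flow_space a b0 s x).
exact: (ccont_continuous_Re (ccont_comp cw (hol_ccont (hol_h up)))).
Qed.

Let integrand_bound s x : 0 <= s -> `|integrand s x| <= B * poisson_kernel a b x.
Proof.
move=> s0; rewrite normrM (ger0_norm (poisson_kernel_ge0 _ _ (ltW b0))) mulrC.
rewrite ler_pM2r ?poisson_kernel_gt0// (le_trans (normr_Re_le _))// bound_h//.
rewrite Im_conformal_flow// divr_ge0 ?mulr_ge0// ?ltW ?flow_denominator_gt0//.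
by rewrite ltr_wpDl ?sqr_ge0 ?exprn_gt0.
Qed.

Let integrable_integrand s : 0 < s -> mu.-integrable setT (EFin \o integrand s).
Proof.
move=> s0; apply: (@integrable_bounded_poisson _ _ a b B) => //.
  by apply: continuous_measurable_fun; exact: continuous_integrand.
by move=> x; apply: integrand_bound; exact: ltW.
Qed.

Let integrable_derivand s : 0 < s < 1 ->
  mu.-integrable setT (EFin \o derivand s).
Proof.
move=> /andP[s0 s1]; have s20 : 0 < s / 2 by rewrite divr_gt0.
have [C HC] := derivand_bound s20.
apply: (@integrable_bounded_poisson _ _ a (b / (s / 2)) C).
- by rewrite divr_gt0.
- by apply: continuous_measurable_fun; exact: continuous_derivand.
- by move=> x; apply: HC => //; lra.
Qed.

(** At a fixed time [s] the flow tends to the same point [a + i b / s] at both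
    ends of the line: the circle closes up, so that a function has no net
    change along it. *)
Let flow_at_infinity (s : R) (F : set_system R) (FF : Filter F) : 0 < s ->
  `|x - a| @[x --> F] --> +oo ->
  ccvg F (fun x : R => w s%:C x%:C) (a +i* (b / s)).
Proof.
move=> s0 Foo.
have s0' : s%:C != 0 :> R[i] by apply/eqP => -[/eqP]; rewrite gt_eqF.
have ii : 'i * 'i = - 1 :> R[i] by rewrite -expr2 sqr_i.
pose K : R := b ^+ 2 * `|s - s^-1| / s.
apply: (@ccvg_modulus_le _ _ _ _ _ _ (fun x => K * `|x - a|^-1)); last first.
  rewrite -[X in _ --> X](mulr0 K); apply: (@cvgM R); first exact: cvg_cst.
  apply/gtr0_cvgV0 => //.
  by move/cvgryPgt : Foo => /(_ 0).
have Fpos : \forall x \near F, 0 < `|x - a| by move/cvgryPgt : Foo => /(_ 0).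
apply: filterS Fpos => x xa.
have d0 := flow_denominator_neq0 a b0 s x.
have -> : a +i* (b / s) = a%:C + 'i * b%:C / s%:C.
  by rewrite -mulrA -real_complexV -real_complexM; apply: complex_eqP;
    rewrite !ReIm /=; ring.
have -> : w s%:C x%:C - (a%:C + 'i * b%:C / s%:C) =
  'i * b%:C ^+ 2 * (s%:C - s%:C^-1) / den s x.
  rewrite /conformal_flow; field: ii.
  by rewrite s0' d0.
have -> : s%:C - s%:C^-1 = (s - s^-1)%:C :> R[i].
  by rewrite real_complexD real_complexN real_complexV.
rewrite 3!modulusM modulusi mul1r modulusV modulusX !modulus_real gtr0_norm//.
rewrite /K -[leRHS]mulrA; apply: ler_wpM2l.
  exact: mulr_ge0 (sqr_ge0 b) (normr_ge0 _).
rewrite -invfM lef_pV2 ?posrE ?modulus_gt0 ?mulr_gt0//.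
rewrite -(@ler_pXn2r _ 2) ?nnegrE ?modulus_ge0 ?mulr_ge0 ?(ltW s0)//.
rewrite modulus_flow_denominator exprMn real_normK ?num_real//.
by rewrite lerDr sqr_ge0.
Qed.

Let integral_derivand s : 0 < s < 1 -> \int[mu]_x derivand s x = 0.
Proof.
move=> s01; have /andP[s0 s1] := s01.
pose F (x : R) := complex.Re ('i * (1 - s ^+ 2)^-1%:C * h (w s%:C x%:C)).
pose l := complex.Re ('i * (1 - s ^+ 2)^-1%:C * h (a +i* (b / s))).
have lim (G : set_system R) : Filter G -> `|x - a| @[x --> G] --> +oo ->
    F x @[x --> G] --> l.
  move=> FG Goo; have cw := flow_at_infinity FG s0 Goo.
  have up : 0 < complex.Im (a +i* (b / s)) by rewrite /= divr_gt0.
  have := hol_ccont (hol_h up) FG cw.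
  by move=> /(ccvgM (@ccvg_cst R _ G FG ('i * (1 - s ^+ 2)^-1%:C))) [].
rewrite -(subrr l); apply: (@FTC_line _ (derivand s) F l l).
- exact: continuous_derivand.
- exact: integrable_derivand.
- by move=> x; exact: derive_space.
- apply: lim; apply/cvgryPge => A.
  apply: filterS (nbhs_pinfty_ge (num_real (A + a))) => x Ax.
  by rewrite (le_trans _ (ler_norm _))// lerBrDr.
- apply: lim; apply/cvgryPge => A.
  apply: filterS (nbhs_ninfty_le (num_real (a - A))) => x Ax.
  by rewrite distrC (le_trans _ (ler_norm _))// lerBrDr addrC -lerBrDr.
Qed.

Let Phi (s : R) := \int[mu]_x integrand s x.

Let derive_Phi (s : R) : 0 < s < 1 -> is_derive s 1 Phi 0.
Proof.
move=> s01; have /andP[s0 s1] := s01.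
have s20 : 0 < s / 2 by rewrite divr_gt0.
have [C HC] := derivand_bound s20.
have sI : `]s / 2, 1[%classic s by rewrite /= in_itv /= s1 andbT; lra.
have I0 (r : R) : `]s / 2, 1[%classic r -> 0 < r.
  by rewrite /= in_itv /= => /andP[+ _]; exact: lt_trans.
have d1E (r x : R) : 0 < r -> partial1of2 integrand r x = derivand r x.
  by move=> r0; rewrite partial1of2E; case: (derive_time x r0).
have bo (r x : R) : `]s / 2, 1[%classic r ->
    `|partial1of2 integrand r x| <= C * poisson_kernel a (b / (s / 2)) x.
  move=> rI; rewrite d1E ?I0//; move: rI; rewrite /= in_itv /= => /andP[? ?].
  exact: HC.
pose G x := C * poisson_kernel a (b / (s / 2)) x.
have G0 x : 0 <= G x by exact: le_trans (normr_ge0 _) (bo s x sI).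
have iG : mu.-integrable setT (EFin \o G).
  apply: (@integrable_bounded_poisson _ _ a (b / (s / 2)) C).
  - by rewrite divr_gt0.
  - apply: measurable_funM => //; apply: continuous_measurable_fun.
    by apply: continuous_poisson_kernel; rewrite divr_gt0.
  - by move=> x; rewrite ger0_norm.
have di (r x : R) : `]s / 2, 1[%classic r -> setT x ->
    derivable (integrand ^~ x) r 1.
  by move=> rI _; case: (derive_time x (I0 r rI)).
have ii (r : R) : `]s / 2, 1[%classic r -> mu.-integrable setT (EFin \o integrand r).
  by move=> rI; apply: integrable_integrand; exact: I0.
have dPhi := derivable_under_integral measurableT sI ii di G0 iG
  (fun r x rI _ => bo r x rI).
apply: DeriveDef => //; rewrite -derive1E.
rewrite (differentiation_under_integral measurableT sI ii di G0 iG
  (fun r x rI _ => bo r x rI)).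
rewrite -[RHS](integral_derivand s01); apply: eq_Rintegral => x _.
exact: d1E.
Qed.

Let Phi_cst s : 0 < s < 1 -> Phi s = Phi (1 / 2).
Proof.
have const (r t : R) : 0 < r -> t < 1 -> r < t -> Phi r = Phi t.
  move=> r0 t1 rt.
  have dI (x : R) : r <= x <= t -> is_derive x 1 Phi 0.
    move=> /andP[rx xt]; apply: derive_Phi.
    by rewrite (lt_le_trans r0 rx) (le_lt_trans xt t1).
  have [||c _] := @MVT _ Phi (fun=> 0) r t rt.
  - by move=> x; rewrite in_itv /= => /andP[/ltW ? /ltW ?]; apply: dI; apply/andP.
  - apply: derivable_within_continuous => x; rewrite in_itv /= => xI.
    by case: (dI x xI).
  - by rewrite mul0r => /eqP; rewrite subr_eq0 => /eqP ->.
move=> /andP[s0 s1]; case: (ltgtP s (1 / 2)) => [s2|s2|-> //].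
- by apply: const => //; lra.
- by apply/esym; apply: const => //; lra.
Qed.

Let integrable_B : mu.-integrable setT (EFin \o (fun x => B * poisson_kernel a b x)).
Proof.
apply: (@integrable_bounded_poisson _ _ a b `|B|) => //.
- apply: measurable_funM => //; apply: continuous_measurable_fun.
  exact: continuous_poisson_kernel.
- by move=> x; rewrite normrM (ger0_norm (poisson_kernel_ge0 _ _ (ltW b0))).
Qed.

Let cvg_Phi (s_ : nat -> R) (f : R -> R) : (forall n, 0 < s_ n < 1) ->
  (forall x, complex.Re (h (w (s_ n)%:C x%:C)) @[n --> \oo] --> f x) ->
  Phi (1 / 2) = \int[mu]_x (poisson_kernel a b x * f x).
Proof.
move=> s01 sf; apply: (@cvg_unique _ (@Rhausdorff R) (Phi (s_ n) @[n --> \oo])).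
  by rewrite (_ : (fun n => Phi (s_ n)) = cst (Phi (1 / 2)));
    [exact: cvg_cst|apply/funext => n; exact: Phi_cst].
apply: (@dominated_cvg_Rintegral _ _ _ _ (fun x => B * poisson_kernel a b x)) => //.
- move=> n; apply: continuous_measurable_fun; apply: continuous_integrand.
  by case/andP: (s01 n).
- by move=> x _; apply: (@cvgM R) (sf x); exact: cvg_cst.
- by move=> n x _; apply: integrand_bound; case/andP: (s01 n) => /ltW.
Qed.

Let cvg_flow (s_ : nat -> R) (s x : R) : s_ n @[n --> \oo] --> s ->
  ccvg \oo (fun n => w (s_ n)%:C x%:C) (w s%:C x%:C).
Proof.
move=> ss; have := hol_ccont (hol_conformal_flow_time a b0 s x).
by apply; exact: ccvg_real.
Qed.

(** The mean of [h] over the circle at time [s], weighted by the Poisson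
    kernel, has as time derivative the integral over the line of an
    [x]-derivative, hence is constant; it tends to the boundary integral as
    [s] tends to 0 and to a multiple of [h (a + i b)] as [s] tends to 1. *)
Lemma poisson_formula_Re :
  \int[mu]_x (poisson_kernel a b x * complex.Re (h x%:C)) =
  pi * complex.Re (h (a +i* b)).
Proof.
have hS : (harmonic n.+1 : R) @[n --> \oo] --> (0 : R).
  by have := @cvg_harmonic R; rewrite -cvg_shiftS.
have hS01 n : 0 < (harmonic n.+1 : R) < 1.
  by rewrite invr_gt0 ltr0n /= invf_lt1 ?ltr0n// ltr1n.
rewrite -(@cvg_Phi (fun n => harmonic n.+1) (fun x => complex.Re (h x%:C))) //; last first.
  move=> x; have := cvg_flow x hS.
  by rewrite (conformal_flow0 _ b0) => /(cont_h _)[].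
rewrite (@cvg_Phi (fun n => 1 - harmonic n.+1) (fun=> complex.Re (h (a +i* b)))).
- rewrite -(Rintegral_poisson_kernel a b0) RintegralZr//.
  exact: integrable_poisson_kernel.
- by move=> n; have /andP[? ?] := hS01 n; lra.
- move=> x; have h1 : 1 - (harmonic n.+1 : R) @[n --> \oo] --> (1 : R).
    rewrite -[X in _ --> X](subr0 1); apply: (@cvgB _ R^o) => //.
    exact: cvg_cst.
  have := cvg_flow x h1; rewrite (conformal_flow1 _ b0).
  have up : 0 < complex.Im (a +i* b) by [].
  by move=> /(hol_ccont (hol_h up) _)[].
Qed.

End poisson_formula.

(** * Probability measures with a density *)

Section densities.
Context {R : realType}.
Notation mu := (@lebesgue_measure R).

Definition has_density (nu : set (measurableTypeR R) -> \bar R) (f : R -> R) :=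
  forall A, measurable A -> nu A = (\int[mu]_(x in A) (f x)%:E)%E.

Section construction.
Variable f : R -> R.
Hypothesis mf : measurable_fun setT f.
Hypothesis f0 : forall x, 0 <= f x.
Hypothesis f1 : (\int[mu]_x (f x)%:E = 1)%E.

(** The hypotheses on [f] are arguments of the definition so that the
    probability structure can be inferred from the term. *)
Definition density_probability of measurable_fun setT f &
    (forall x, 0 <= f x) & (\int[mu]_x (f x)%:E = 1)%E :
    set (measurableTypeR R) -> \bar R :=
  fun A => (\int[mu]_(x in A) (f x)%:E)%E.

Local Notation P := (density_probability mf f0 f1).

Let P0 : P set0 = 0%E.
Proof. by rewrite /density_probability integral_set0. Qed.

Let P_ge0 A : (0 <= P A)%E.
Proof. by apply: integral_ge0 => x _; rewrite lee_fin. Qed.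

Let P_sigma_additive : semi_sigma_additive P.
Proof.
move=> A mA tA mUA; rewrite /density_probability ge0_integral_bigcup//.
- apply: is_cvg_ereal_nneg_natsum_cond => n _ _; exact: P_ge0.
- by apply: measurable_funTS; exact/measurable_EFinP.
- by move=> x _; rewrite lee_fin.
Qed.

HB.instance Definition _ := isMeasure.Build _ _ _ P P0 P_ge0 P_sigma_additive.

Let P1 : P setT = 1%E. Proof. exact: f1. Qed.

HB.instance Definition _ := Measure_isProbability.Build _ _ R P P1.

Lemma exists_probability_density :
  exists nu : probability (measurableTypeR R) R, has_density nu f.
Proof. by exists (P : probability (measurableTypeR R) R). Qed.

End construction.

Lemma bounded_integrable (nu : probability (measurableTypeR R) R)
    (g : R -> R) (C : R) : measurable_fun setT g -> (forall x, `|g x| <= C) ->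
  nu.-integrable setT (EFin \o g).
Proof.
move=> mg gC.
apply: (@le_integrable _ _ _ nu setT measurableT _ (EFin \o cst `|C|)).
- exact/measurable_EFinP.
- by move=> x _; rewrite /= lee_fin normr_id (le_trans (gC x))// ler_norm.
- exact: finite_measure_integrable_cst.
Qed.

(** A density is a Radon-Nikodym derivative. *)
Lemma Rintegral_density (nu : probability (measurableTypeR R) R)
    (f g : R -> R) C :
  mu.-integrable setT (EFin \o f) -> has_density nu f ->
  measurable_fun setT g -> (forall x, `|g x| <= C) ->
  \int[nu]_x g x = \int[mu]_x (g x * f x).
Proof.
move=> intf df mg gC.
have mf : measurable_fun setT f.
  by apply/measurable_EFinP; exact: measurable_int intf.
have dom : nu `<< mu.
  apply/null_content_dominatesP => A mA A0; rewrite df//.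
  apply: null_set_integral => //; apply: measurable_funTS.
  exact/measurable_EFinP.
have ig := bounded_integrable nu mg gC.
rewrite /Rintegral; congr fine.
have <- := Radon_Nikodym_change_of_variables dom measurableT ig.
pose nu' := charge_of_finite_measure nu.
have iRN := @Radon_Nikodym_integrable _ _ _ nu' mu dom.
have mRN := measurable_int _ iRN.
apply: ae_eq_integral => //.
- by apply: emeasurable_funM => //; exact/measurable_EFinP.
- by apply/measurable_EFinP; exact: measurable_funM.
- under [X in ae_eq _ _ _ X]eq_fun do rewrite EFinM.
  apply: ae_eqe_mul2l; apply: integral_ae_eq => //.
  + exact/measurable_EFinP.
  + by move=> A _ mA; rewrite -(@Radon_Nikodym_integral _ _ _ nu' mu)//; exact: df.
Qed.

End densities.

(** * Cauchy's formula and the realization of Cauchy transforms *)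

Section upper_half_plane.
Context {R : realType}.
Notation mu := (@lebesgue_measure R).
Implicit Types (z : R[i]) (h f g : R[i] -> R[i]).

Definition upper_analytic h : Prop := exists h' : R[i] -> R[i],
  [/\ forall z, 0 < complex.Im z -> hol h z (h' z),
      forall z, 0 < complex.Im z -> ccont h' z &
      forall x : R, ccont h x%:C].

Definition upper_bounded h : Prop :=
  exists B : R, forall z, 0 <= complex.Im z -> modulus (h z) <= B.

Lemma upper_analytic_hol h h' :
  (forall z, 0 <= complex.Im z -> hol h z (h' z)) ->
  (forall z, 0 <= complex.Im z -> ccont h' z) -> upper_analytic h.
Proof.
move=> hh ch'; exists h'; split.
- by move=> z z0; exact/hh/ltW.
- by move=> z z0; exact/ch'/ltW.
- by move=> x; apply: hol_ccont (hh _ _).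
Qed.

Lemma upper_analytic_ccont h z : upper_analytic h -> 0 <= complex.Im z ->
  ccont h z.
Proof.
move=> [h' [hh _ ch]]; rewrite le_eqVlt => /predU1P[z0|/hh/hol_ccont //].
have -> : z = (complex.Re z)%:C by apply: complex_eqP.
exact: ch.
Qed.

Lemma upper_analytic_cst (c : R[i]) : upper_analytic (fun=> c).
Proof.
apply: (@upper_analytic_hol _ (fun=> 0)) => z _; first exact: hol_cst.
exact: ccont_cst.
Qed.

Lemma upper_analytic_id : upper_analytic id.
Proof.
apply: (@upper_analytic_hol _ (fun=> 1)) => z _; first exact: hol_id.
exact: ccont_cst.
Qed.

Lemma upper_analyticD f g : upper_analytic f -> upper_analytic g ->
  upper_analytic (fun z => f z + g z).
Proof.
move=> [f' [hf cf' cf]] [g' [hg cg' cg]]; exists (fun z => f' z + g' z).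
split => [z z0|z z0|x].
- by apply: holD; [exact: hf|exact: hg].
- by apply: ccontD; [exact: cf'|exact: cg'].
- exact: ccontD.
Qed.

Lemma upper_analyticN f : upper_analytic f -> upper_analytic (fun z => - f z).
Proof.
move=> [f' [hf cf' cf]]; exists (fun z => - f' z).
split => [z z0|z z0|x].
- by apply: holN; exact: hf.
- by apply: ccontN; exact: cf'.
- exact: ccontN.
Qed.

Lemma upper_analyticM f g : upper_analytic f -> upper_analytic g ->
  upper_analytic (fun z => f z * g z).
Proof.
move=> uf ug; move: (uf) (ug).
move=> [f' [hf cf' cf]] [g' [hg cg' cg]].
exists (fun z => f' z * g z + f z * g' z); split => [z z0|z z0|x].
- by apply: holM; [exact: hf|exact: hg].
- by apply: ccontD; apply: ccontM; [exact: cf'|exact: hol_ccont (hg _ z0)|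
    exact: hol_ccont (hf _ z0)|exact: cg'].
- exact: ccontM.
Qed.

Lemma upper_analyticV f : upper_analytic f ->
  (forall z, 0 <= complex.Im z -> f z != 0) ->
  upper_analytic (fun z => (f z)^-1).
Proof.
move=> [f' [hf cf' cf]] f0; exists (fun z => - f' z / f z ^+ 2).
split => [z z0|z z0|x].
- by apply: holV; [exact/f0/ltW|exact: hf].
- have cfz := hol_ccont (hf _ z0); have fz := f0 _ (ltW z0).
  apply: ccontM; first by apply: ccontN; exact: cf'.
  apply: (@ccontV _ (fun z => f z * f z)); first by rewrite mulf_neq0.
  exact: ccontM.
- by apply: ccontV; [apply: f0|].
Qed.

Lemma upper_analyticZ (k : R[i]) f : upper_analytic f ->
  upper_analytic (fun z => k * f z).
Proof. by move=> uf; apply: upper_analyticM => //; exact: upper_analytic_cst. Qed.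

Lemma upper_analytic_dilation (c : R) f : 0 < c -> upper_analytic f ->
  upper_analytic (fun z => f (c%:C * z)).
Proof.
move=> c0 [f' [hf cf' cf]]; exists (fun z => f' (c%:C * z) * (c%:C * 1)).
have up z : 0 < complex.Im z -> 0 < complex.Im (c%:C * z).
  by move=> z0; rewrite complexIm_M /= mul0r addr0 mulr_gt0.
have hc z : hol (fun z => c%:C * z) z (c%:C * 1) by apply: holZ; exact: hol_id.
split => [z z0|z z0|x].
- by apply: (hol_comp (hc z)); exact/hf/up.
- apply: ccontM; last exact: ccont_cst.
  exact: (ccont_comp (hol_ccont (hc z)) (cf' _ (up _ z0))).
- apply: (ccont_comp (hol_ccont (hc x%:C))).
  by rewrite -real_complexM; exact: cf.
Qed.

(** On a disc a bound comes from compactness, so only the behaviour at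
    infinity matters. *)
Lemma upper_bounded_infinity h (M B : R) : upper_analytic h ->
  (forall z, 0 <= complex.Im z -> M < modulus z -> modulus (h z) <= B) ->
  upper_bounded h.
Proof.
move=> uh hB.
have [z _ /andP[z0 _]|C HC] := @ccont_bounded_rectangle _ h (- M) M 0 M.
  exact: upper_analytic_ccont.
exists (Num.max B C) => z z0; rewrite le_max.
have [zM|zM] := ltP M (modulus z); first by rewrite hB.
rewrite HC ?orbT//.
- by rewrite -ler_norml (le_trans (normr_Re_le _)).
- by rewrite z0 (le_trans _ zM)// (le_trans _ (normr_Im_le _))// ler_norm.
Qed.

Section poisson.
Variable h : R[i] -> R[i].
Hypotheses (uh : upper_analytic h) (bh : upper_bounded h).

Lemma poisson_Re z : 0 < complex.Im z ->
  \int[mu]_x (poisson_kernel (complex.Re z) (complex.Im z) x *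
              complex.Re (h x%:C)) = pi * complex.Re (h z).
Proof.
case: z => a b /= b0; case: uh => h' [hh ch' ch]; case: bh => B Bh.
exact: (poisson_formula_Re a b0 hh ch' ch Bh).
Qed.

Lemma integrable_poisson_Re (a b : R) : 0 < b -> mu.-integrable setT
  (EFin \o (fun x => poisson_kernel a b x * complex.Re (h x%:C))).
Proof.
move=> b0; case: uh => h' [hh ch' ch]; case: bh => B Bh.
apply: (@integrable_bounded_poisson _ _ a b B) => //.
  apply: continuous_measurable_fun => x; apply: (@cvgM R).
    exact: continuous_poisson_kernel.
  by apply: ccont_continuous_Re; exact: ch.
move=> x; have P0 := poisson_kernel_gt0 a x b0.
rewrite normrM gtr0_norm// mulrC ler_pM2r// (le_trans (normr_Re_le _))//.
exact: Bh.
Qed.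

End poisson.

Lemma Re_mulNi z : complex.Re (- 'i * z) = complex.Im z.
Proof. by rewrite !ReIm /=; ring. Qed.

Lemma upper_boundedZ (k : R[i]) h : upper_bounded h ->
  upper_bounded (fun z => k * h z).
Proof.
move=> [B HB]; exists (modulus k * B) => z z0; rewrite modulusM.
by rewrite ler_wpM2l ?modulus_ge0// HB.
Qed.

Lemma poisson_Im h z : upper_analytic h -> upper_bounded h ->
  0 < complex.Im z ->
  \int[mu]_x (poisson_kernel (complex.Re z) (complex.Im z) x *
              complex.Im (h x%:C)) = pi * complex.Im (h z).
Proof.
move=> uh bh z0.
have := poisson_Re (upper_analyticZ (- 'i) uh) (upper_boundedZ (- 'i) bh) z0.
rewrite Re_mulNi => <-.
by apply: eq_Rintegral => x _; rewrite Re_mulNi.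
Qed.

Lemma integrable_poisson_Im h (a b : R) : upper_analytic h -> upper_bounded h ->
  0 < b -> mu.-integrable setT
  (EFin \o (fun x => poisson_kernel a b x * complex.Im (h x%:C))).
Proof.
move=> uh bh b0.
have := integrable_poisson_Re (upper_analyticZ (- 'i) uh)
  (upper_boundedZ (- 'i) bh) a b0.
by under eq_fun do rewrite Re_mulNi.
Qed.

Lemma ccont_cauchy_kernel z (x : R) : 0 < complex.Im z ->
  ccont (fun w => 1 / (z - w)) x%:C.
Proof.
move=> z0; apply: ccontM; first exact: ccont_cst.
apply: (@ccontV _ (fun w => z - w)).
  by apply: upper_neq0; rewrite !ReIm /= oppr0 addr0.
by apply: ccontD; [exact: ccont_cst|apply: ccontN; exact: ccont_id].
Qed.

Lemma modulus_cauchy_kernel z (x : R) : 0 < complex.Im z ->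
  modulus (1 / (z - x%:C)) <= (complex.Im z)^-1.
Proof.
move=> z0; rewrite mul1r modulusV lef_pV2 ?posrE//; last first.
  by apply: modulus_gt0; apply: upper_neq0; rewrite !ReIm /= oppr0 addr0.
rewrite (le_trans _ (normr_Im_le _))// !ReIm /= oppr0 addr0.
exact: ler_norm.
Qed.

Section cauchy.
Variable h : R[i] -> R[i].
Hypotheses (uh : upper_analytic h) (bh : upper_bounded h).
Hypothesis bzh : upper_bounded (fun z => z * h z).

Definition boundary_density (x : R) : R := complex.Im (h x%:C) / pi.

Let pi0 : (pi : R) != 0. Proof. by rewrite gt_eqF// pi_gt0. Qed.

Lemma continuous_boundary_density : continuous boundary_density.
Proof.
move=> x; apply: (@cvgM R); last exact: cvg_cst.
by apply: ccont_continuous_Im; apply: upper_analytic_ccont.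
Qed.

Lemma measurable_boundary_density : measurable_fun setT boundary_density.
Proof.
by apply: continuous_measurable_fun; exact: continuous_boundary_density.
Qed.

Let kernel_neq0 (a b x : R) : 0 < b -> (x - a) ^+ 2 + b ^+ 2 != 0.
Proof. by move=> b0; rewrite gt_eqF// ltr_wpDl ?sqr_ge0 ?exprn_gt0. Qed.

Lemma Im_cauchy_kernel z (x : R) : 0 < complex.Im z ->
  complex.Im (1 / (z - x%:C)) = - poisson_kernel (complex.Re z) (complex.Im z) x.
Proof.
move=> z0; rewrite mul1r complexIm_V !ReIm /= oppr0 addr0.
by rewrite -sqrrN opprB mulNr.
Qed.

Lemma Re_cauchy_kernel z (x : R) : 0 < complex.Im z ->
  complex.Re (1 / (z - x%:C)) = - (x - complex.Re z) / complex.Im z *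
    poisson_kernel (complex.Re z) (complex.Im z) x.
Proof.
move=> z0; rewrite mul1r complexRe_V !ReIm /= oppr0 addr0.
rewrite -sqrrN opprB /poisson_kernel; field.
by rewrite kernel_neq0// gt_eqF.
Qed.

Lemma boundary_density_Im z : 0 < complex.Im z ->
  \int[mu]_x (complex.Im (1 / (z - x%:C)) * boundary_density x) =
  - complex.Im (h z).
Proof.
move=> z0; have H := poisson_Im uh bh z0.
have -> : - complex.Im (h z) = - pi^-1 * (pi * complex.Im (h z)).
  by move: pi0; move: (pi : R) => p p0; field.
rewrite -H -RintegralZl//; last exact: integrable_poisson_Im.
apply: eq_Rintegral => x _; rewrite Im_cauchy_kernel//.
by rewrite /boundary_density; ring.
Qed.

(** Poisson's formula for [(w - z) h w], which vanishes at [w = z], evaluates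
    the conjugate Poisson integral. *)
Lemma boundary_density_Re z : 0 < complex.Im z ->
  \int[mu]_x (complex.Re (1 / (z - x%:C)) * boundary_density x) =
  - complex.Re (h z).
Proof.
move=> z0; pose g w := w * h w + (- z) * h w.
have ug : upper_analytic g.
  apply: upper_analyticD; last exact: upper_analyticZ.
  by apply: upper_analyticM => //; exact: upper_analytic_id.
have bg : upper_bounded g.
  case: bzh (upper_boundedZ (- z) bh) => [B HB] [B' HB'].
  exists (B + B') => w w0; rewrite (le_trans (modulusD _ _))// lerD ?HB ?HB'//.
have Hg := poisson_Im ug bg z0; have Hh := poisson_Re uh bh z0.
have ig := integrable_poisson_Im (complex.Re z) ug bg z0.
have ih := integrable_poisson_Re uh bh (complex.Re z) z0.
have gz : g z = 0 by rewrite /g mulNr subrr.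
move: Hg; rewrite gz mulr0 => Hg.
have -> : - complex.Re (h z) = - (pi^-1 * (complex.Im z)^-1) *
    (0 + complex.Im z * (pi * complex.Re (h z))).
  by move: pi0; move: (pi : R) => p p0; field; rewrite p0 gt_eqF.
have ibh := integrable_mull (complex.Im z) measurableT ih.
rewrite -Hg -Hh -RintegralZl// -RintegralD// -RintegralZl//; last first.
  exact: integrable_add.
apply: eq_Rintegral => x _; rewrite Re_cauchy_kernel//.
rewrite /boundary_density /g !ReIm /=.
by move: pi0; move: (pi : R) => p p0; field; rewrite p0 gt_eqF.
Qed.

Hypothesis boundary_ge0 : forall x : R, 0 <= complex.Im (h x%:C).

Let density_ge0 x : 0 <= boundary_density x.
Proof. by rewrite divr_ge0// pi_ge0. Qed.

(** Cauchy's formula: the Poisson and the conjugate Poisson integral are the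
    imaginary and the real part of an integral against the Cauchy kernel. *)
Lemma cauchy_transform_boundary (nu : probability (measurableTypeR R) R) z :
  has_density nu boundary_density -> 0 < complex.Im z ->
  cauchy_transform nu z = - h z.
Proof.
move=> df z0.
have intf : mu.-integrable setT (EFin \o boundary_density).
  apply/integrableP; split.
    by apply/measurable_EFinP; exact: measurable_boundary_density.
  under eq_integral => x _ do rewrite /= ger0_norm//.
  by rewrite -df// probability_setT ltry.
rewrite /cauchy_transform; apply: complex_eqP; rewrite /= !ReIm.
- rewrite -(boundary_density_Re z0); apply: (@Rintegral_density _ _ _ _ (complex.Im z)^-1) => //.
  + by apply: continuous_measurable_fun => x;
      apply: (@ccont_continuous_Re _ (fun w => 1 / (z - w)));
      exact: ccont_cauchy_kernel.
  + by move=> x; exact: le_trans (normr_Re_le _) (modulus_cauchy_kernel x z0).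
- rewrite -(boundary_density_Im z0); apply: (@Rintegral_density _ _ _ _ (complex.Im z)^-1) => //.
  + by apply: continuous_measurable_fun => x;
      apply: (@ccont_continuous_Im _ (fun w => 1 / (z - w)));
      exact: ccont_cauchy_kernel.
  + by move=> x; exact: le_trans (normr_Im_le _) (modulus_cauchy_kernel x z0).
Qed.

(** Testing Poisson's formula at [i y] and letting [y] grow: [y] times the
    kernel increases to 1 and [y * Im h (i y)] tends to 1. *)
Lemma boundary_density_mass (C : R) :
  (forall z, 0 <= complex.Im z -> modulus z * modulus (z * h z + 1) <= C) ->
  (\int[mu]_x (boundary_density x)%:E = 1)%E.
Proof.
move=> hC; pose t (n : nat) : R := n.+1%:R.
have t0 n : 0 < t n by rewrite ltr0n.
pose g n x := t n * poisson_kernel 0 (t n) x * boundary_density x.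
have gE n x : t n * poisson_kernel 0 (t n) x = 1 - x ^+ 2 / (x ^+ 2 + t n ^+ 2).
  have := kernel_neq0 0 x (t0 n); rewrite /poisson_kernel subr0.
  by move: (t n) => y y0; field.
have mP n : measurable_fun setT (poisson_kernel 0 (t n)).
  by apply: continuous_measurable_fun; exact: continuous_poisson_kernel.
have lim1 : (\int[mu]_x (g n x)%:E @[n --> \oo] -->
    \int[mu]_x (boundary_density x)%:E)%E.
  have -> : (\int[mu]_x (boundary_density x)%:E =
      \int[mu]_x (limn (fun n => (g n x)%:E)))%E.
    apply: eq_integral => x _; apply/esym/cvg_lim => //.
    suff c : g n x @[n --> \oo] --> boundary_density x.
      by apply: cvg_EFin; [exact: nearW|exact: c].
    have c1 : (x ^+ 2 + t n ^+ 2)^-1 @[n --> \oo] --> 0.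
      apply: (@squeeze_cvgr _ _ _ _ (cst 0) harmonic).
      - apply: nearW => n; rewrite /= invr_ge0 addr_ge0 ?sqr_ge0//=.
        rewrite lef_pV2 ?posrE//; last by rewrite ltr_wpDl ?sqr_ge0 ?exprn_gt0.
        rewrite (@le_trans _ _ (t n ^+ 2)) ?lerDr ?sqr_ge0//.
        by rewrite expr2 ler_pMr// ler1n.
      - exact: cvg_cst.
      - exact: cvg_harmonic.
    have c2 : x ^+ 2 * (x ^+ 2 + t n ^+ 2)^-1 @[n --> \oo] --> x ^+ 2 * 0.
      by apply: (@cvgM R) => //; exact: cvg_cst.
    have c3 : t n * poisson_kernel 0 (t n) x @[n --> \oo] --> 1 - x ^+ 2 * 0.
      under eq_fun do rewrite gE.
      by apply: (@cvgB _ R^o); first exact: cvg_cst.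
    rewrite (_ : boundary_density x = (1 - x ^+ 2 * 0) * boundary_density x).
      by apply: (@cvgM R); last exact: cvg_cst.
    by rewrite mulr0 subr0 mul1r.
  apply: cvg_monotone_convergence => //.
  - move=> n; apply/measurable_EFinP; apply: measurable_funM; last first.
      exact: measurable_boundary_density.
    by apply: measurable_funM; [exact: measurable_cst|exact: mP].
  - move=> n x _; rewrite lee_fin; apply: mulr_ge0; last exact: density_ge0.
    apply: mulr_ge0; first exact: ltW.
    by apply: poisson_kernel_ge0; exact: ltW.
  - move=> x _ m n mn; rewrite lee_fin; apply: ler_wpM2r.
      exact: density_ge0.
    have d k : 0 < x ^+ 2 + t k ^+ 2 by rewrite ltr_wpDl ?sqr_ge0 ?exprn_gt0.
    rewrite !gE lerD2l lerN2; apply: ler_wpM2l; first exact: sqr_ge0.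
    rewrite lef_pV2 ?posrE// lerD2l lerXn2r ?nnegrE ?(ltW (t0 _))//.
    by rewrite ler_nat.
have E n : (\int[mu]_x (g n x)%:E = (t n * complex.Im (h ('i * (t n)%:C)))%:E)%E.
  have iP := integrable_poisson_Im 0 uh bh (t0 n).
  have z0 : 0 < complex.Im ('i * (t n)%:C) by rewrite !ReIm /= mul0r add0r mul1r.
  have := poisson_Im uh bh z0.
  rewrite !ReIm /= !(mul0r, mul1r, mulr0, sub0r, oppr0, addr0, add0r) => H.
  have -> : t n * complex.Im (h ('i * (t n)%:C)) =
     t n / pi * (pi * complex.Im (h ('i * (t n)%:C))).
    by move: pi0; move: (pi : R) => p p0; field.
  rewrite -H EFinM /Rintegral fineK; last exact: (integrable_fin_num measurableT iP).
  rewrite -integralZl//; apply: eq_integral => x _; rewrite -EFinM; congr EFin.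
  by rewrite /g /boundary_density; move: pi0; move: (pi : R) => p p0; field.
have lim2 : ((t n * complex.Im (h ('i * (t n)%:C)))%:E @[n --> \oo] --> 1%:E)%E.
  apply: cvg_EFin; first exact: nearW.
  apply/(@cvgrPdist_le _ R^o) => e e0.
  have CC : C * harmonic n @[n --> \oo] --> 0.
    rewrite -[X in _ --> X](mulr0 C); apply: (@cvgM R); first exact: cvg_cst.
    exact: cvg_harmonic.
  move/(@cvgrPdist_le _ R^o) : CC => /(_ e e0); apply: filterS => n.
  rewrite sub0r normrN => Ce.
  pose z : R[i] := 'i * (t n)%:C.
  have z0 : 0 <= complex.Im z by rewrite !ReIm /= mul0r add0r mul1r ltW.
  have mz : modulus z = t n by rewrite modulusM modulusi mul1r modulus_real gtr0_norm.
  have -> : 1 - t n * complex.Im (h z) = complex.Re (z * h z + 1).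
    by rewrite /z !ReIm /=; ring.
  rewrite (le_trans (normr_Re_le _))// (le_trans _ Ce)//.
  rewrite (le_trans _ (ler_norm _))// ler_pdivlMr// mulrC.
  by rewrite -[n.+1%:R]/(t n) -mz; exact: hC.
move: lim1; under eq_fun do rewrite E.
by move=> lim1; exact: cvg_unique lim1 lim2.
Qed.

End cauchy.

Lemma upper_bounded_mulz h (C : R) : upper_analytic h ->
  (forall z, 0 <= complex.Im z -> modulus z * modulus (z * h z + 1) <= C) ->
  upper_bounded (fun z => z * h z).
Proof.
move=> uh hC; apply: (@upper_bounded_infinity _ 1 (`|C| + 1)).
  by apply: upper_analyticM => //; exact: upper_analytic_id.
move=> z z0 z1; rewrite -[z * h z](addrK 1) (le_trans (modulusB _ _))//.
rewrite modulus1 lerD2r (le_trans _ (ler_norm _))// (le_trans _ (hC z z0))//.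
by rewrite ler_peMl ?modulus_ge0// ltW.
Qed.

(** The measure is [Im h / pi] on the line: Cauchy's formula identifies its
    transform, and the behaviour of [h] at infinity its mass. *)
Theorem cauchy_transform_realization h (C : R) :
  upper_analytic h -> upper_bounded h ->
  (forall z, 0 <= complex.Im z -> modulus z * modulus (z * h z + 1) <= C) ->
  (forall x : R, 0 <= complex.Im (h x%:C)) ->
  exists nu : probability (measurableTypeR R) R,
    forall z, 0 < complex.Im z -> cauchy_transform nu z = - h z.
Proof.
move=> uh bh hC h0; have bzh := upper_bounded_mulz uh hC.
have d0 x : 0 <= boundary_density h x by rewrite divr_ge0// pi_ge0.
have [nu df] := exists_probability_density (measurable_boundary_density uh) d0
  (boundary_density_mass uh bh h0 hC).
by exists nu => z z0; exact: cauchy_transform_boundary.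
Qed.

End upper_half_plane.

(** * The complex exponential *)

Section complex_exponential.
Context {R : realType}.
Implicit Types (u v z w : R[i]).

Definition cexp u : R[i] :=
  (expR (complex.Re u) * cos (complex.Im u)) +i*
  (expR (complex.Re u) * sin (complex.Im u)).

Lemma cexpD u v : cexp (u + v) = cexp u * cexp v.
Proof.
by apply: complex_eqP; rewrite [RHS]ReIm /= !ReIm expRD ?cosD ?sinD; ring.
Qed.

Lemma modulus_cexp u : modulus (cexp u) = expR (complex.Re u).
Proof.
rewrite modulusE /= !exprMn -mulrDr cos2Dsin2 mulr1 sqrtr_sqr ger0_norm//.
Qed.

Lemma cexp0 : cexp 0 = 1.
Proof. by apply: complex_eqP; rewrite /= ?sin0 ?cos0 expR0 ?mulr0 ?mulr1. Qed.

Lemma normr_sin_le (x : R) : `|sin x| <= `|x|.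
Proof.
have cs (a b : R) : {within `[a, b], continuous (@sin R)}.
  by apply: continuous_subspaceT; exact: continuous_sin.
have ds (a b t : R) : t \in `]a, b[ -> is_derive t 1 (@sin R) (cos t).
  by move=> _; exact: is_derive_sin.
case: (leP 0 x) => [x0|/ltW x0].
- have [c _] := @MVT_segment _ _ _ 0 x x0 (ds 0 x) (cs 0 x).
  rewrite sin0 !subr0 => ->; rewrite normrM ler_piMl//.
  by rewrite ler_norml cos_geN1 cos_le1.
- have [c _] := @MVT_segment _ _ _ x 0 x0 (ds x 0) (cs x 0).
  rewrite sin0 !sub0r => /eqP; rewrite eqr_oppLR mulrN opprK => /eqP ->.
  by rewrite normrM ler_piMl// ler_norml cos_geN1 cos_le1.
Qed.

(** Through [1 - cos x = 2 sin^2 (x / 2)]. *)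
Lemma normr_cosB1_le (x : R) : `|cos x - 1| <= x ^+ 2 / 2.
Proof.
have -> : cos x - 1 = - (2 * sin (x / 2) ^+ 2).
  rewrite {1}(_ : x = x / 2 + x / 2); last by field.
  by rewrite cosD; have := cos2Dsin2 (x / 2); lra.
rewrite normrN (ger0_norm (mulr_ge0 (ler0n _ 2) (sqr_ge0 _))).
have : `|sin (x / 2)| ^+ 2 <= `|x / 2| ^+ 2.
  by rewrite lerXn2r ?nnegrE// normr_sin_le.
by rewrite !real_normK ?num_real//; lra.
Qed.

Lemma normr_sinB_le (x : R) : `|sin x - x| <= x ^+ 2.
Proof.
have key (y : R) : 0 <= y -> `|sin y - y| <= y ^+ 2.
  move=> y0.
  have ds (t : R) : t \in `]0, y[ -> is_derive t 1 (fun t : R => sin t - t) (cos t - 1).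
    by move=> _; apply: is_derive_eq.
  have cs : {within `[0, y], continuous (fun t : R => sin t - t)}.
    apply: continuous_subspaceT => z; apply: (@cvgB _ R^o).
      exact: continuous_sin.
    exact: cvg_id.
  have [c] := @MVT_segment _ _ _ 0 y y0 ds cs.
  rewrite in_itv /= => /andP[c0 cy]; rewrite sin0 !subr0 => ->.
  rewrite normrM (ger0_norm y0) expr2 ler_wpM2r//.
  have -> : cos c - 1 = - (2 * sin (c / 2) ^+ 2).
    rewrite {1}(_ : c = c / 2 + c / 2); last by field.
    by rewrite cosD; have := cos2Dsin2 (c / 2); lra.
  rewrite normrN (ger0_norm (mulr_ge0 (ler0n _ 2) (sqr_ge0 _))).
  have := normr_sin_le (c / 2); rewrite [X in _ <= X]ger0_norm; last by lra.
  have : `|sin (c / 2)| <= 1 by rewrite ler_norml sin_geN1 sin_le1.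
  rewrite -(real_normK (num_real (sin (c / 2)))).
  have := normr_ge0 (sin (c / 2)); move: `|_| => s s0 s1 sc.
  have : s * s <= 1 * s by rewrite ler_wpM2r.
  by rewrite -expr2; lra.
case: (leP 0 x) => [|/ltW x0]; first exact: key.
have := key (- x); rewrite oppr_ge0 sinN sqrrN => /(_ x0).
by rewrite -opprD normrN.
Qed.

Lemma normr_expRB1_le (x : R) : `|expR x - 1| <= `|x| * expR `|x|.
Proof.
have e1 := expR_ge1Dx x; have e2 := expR_ge1Dx (- x).
have e0 := expR_gt0 x.
have e3 : expR x * (1 - x) <= 1.
  by rewrite -[leRHS]expR0 -(subrr x) expRD ler_pM2l.
case: (leP 0 x) => x0.
- rewrite !ger0_norm//; last by lra.
  by rewrite mulrBr mulr1 in e3; rewrite mulrC; lra.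
- have x0' := ltW x0; rewrite (ler0_norm x0') ler0_norm; last first.
    by rewrite subr_le0 -[leRHS]expR0 ler_expR.
  have : 1 <= expR (- x) by rewrite -[leLHS]expR0 ler_expR oppr_ge0.
  move=> h; have : - x * 1 <= - x * expR (- x) by rewrite ler_wpM2l// oppr_ge0.
  lra.
Qed.

Lemma normr_expRB1B_le (x : R) : `|expR x - 1 - x| <= x ^+ 2 * expR `|x|.
Proof.
have e1 := expR_ge1Dx x.
have e3 : expR x * (1 - x) <= 1.
  by rewrite -[leRHS]expR0 -(subrr x) expRD ler_pM2l ?expR_gt0// expR_ge1Dx.
rewrite ger0_norm; last by lra.
apply: (@le_trans _ _ (x * (expR x - 1))).
  by rewrite mulrBr mulr1 in e3; rewrite mulrBr mulr1 mulrC; lra.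
apply: (le_trans (ler_norm _)); rewrite normrM.
rewrite -(real_normK (num_real x)) expr2 -mulrA ler_wpM2l//.
exact: normr_expRB1_le.
Qed.

Lemma modulus_cexp_taylor u :
  modulus (cexp u - 1 - u) <= 3 * modulus u ^+ 2 * expR (modulus u).
Proof.
case: u => a b; rewrite modulus_sqr /=.
have ma := normr_Re_le (a +i* b); rewrite /= in ma.
set m := modulus (a +i* b) in ma *.
have em : expR `|a| <= expR m by rewrite ler_expR.
have e1 : 1 <= expR `|a| by rewrite -[leLHS]expR0 ler_expR.
rewrite (le_trans (modulus_le _))// !ReIm /= !(oppr0, addr0).
have hRe : `|expR a * cos b - 1 - a| <= (a ^+ 2 + b ^+ 2) * expR `|a|.
  have -> : expR a * cos b - 1 - a =
    (expR a - 1 - a) * cos b + (1 + a) * (cos b - 1) by ring.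
  apply: (le_trans (ler_normD _ _)); rewrite [leRHS]mulrDl; apply: lerD.
    rewrite normrM -[leRHS]mulr1; apply: ler_pM => //.
      exact: normr_expRB1B_le.
    by rewrite ler_norml cos_geN1 cos_le1.
  rewrite normrM mulrC; apply: ler_pM => //.
    by rewrite (le_trans (normr_cosB1_le _))//; have := sqr_ge0 b; lra.
  apply: (le_trans (ler_normD _ _)); rewrite normr1.
  exact: expR_ge1Dx.
have hIm : `|expR a * sin b - b| <= (3 / 2 * a ^+ 2 + 3 / 2 * b ^+ 2) * expR `|a|.
  have -> : expR a * sin b - b = (expR a - 1) * sin b + (sin b - b) by ring.
  rewrite (le_trans (ler_normD _ _))// normrM.
  apply: (@le_trans _ _ (`|a| * expR `|a| * `|b| + b ^+ 2 * expR `|a|)).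
    apply: lerD.
      apply: ler_pM => //; first exact: normr_expRB1_le.
      exact: normr_sin_le.
    rewrite (le_trans (normr_sinB_le _))// ler_peMr ?sqr_ge0//.
  rewrite mulrAC -mulrDl ler_wpM2r ?expR_ge0//.
  rewrite -(real_normK (num_real a)) -(real_normK (num_real b)).
  have := sqr_ge0 (`|a| - `|b|); rewrite sqrrB.
  move: `|a| `|b| => x y; have := sqr_ge0 x; have := sqr_ge0 y; lra.
have s0 : 0 <= a ^+ 2 + b ^+ 2 by rewrite addr_ge0 ?sqr_ge0.
rewrite (@le_trans _ _ (3 * (a ^+ 2 + b ^+ 2) * expR `|a|))//; last first.
  by rewrite ler_wpM2l// mulr_ge0.
have : 0 <= (a ^+ 2 + b ^+ 2) * expR `|a| by rewrite mulr_ge0 ?expR_ge0.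
lra.
Qed.

(** The exponential and the Fourier moments below come with explicit Taylor
    remainders, so this is how they are shown to be holomorphic. *)
Lemma hol_quadratic (f : R[i] -> R[i]) z d (K : R) :
  (forall w, modulus (w - z) <= 1 ->
     modulus (f w - f z - d * (w - z)) <= K * modulus (w - z) ^+ 2) ->
  hol f z d.
Proof.
move=> Kf; exists (fun w => if w == z then d else (f w - f z) / (w - z)).
split; last 2 first.
- by rewrite eqxx.
- move=> T F FF g gz; rewrite eqxx.
  have gz0 : modulus (g x - z) @[x --> F] --> 0.
    have H := @ccvgD R _ F FF _ _ _ _ gz (@ccvg_cst R _ F FF (- z)).
    by have := ccvg_modulus H; rewrite subrr modulus0; apply.
  apply: (@ccvg_modulus_le _ _ _ _ _ _ (fun x => K * modulus (g x - z))); last first.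
    rewrite -[X in _ --> X](mulr0 K); apply: (@cvgM R) => //; exact: cvg_cst.
  have small : \forall x \near F, modulus (g x - z) <= 1.
    move/(@cvgrPdist_le _ R^o) : gz0 => /(_ 1 ltr01); apply: filterS => x.
    by rewrite sub0r normrN ger0_norm// modulus_ge0.
  apply: filterS small => x /Kf Kx /=.
  case: eqVneq => [->|gxz]; first by rewrite !subrr modulus0 mulr0.
  have n0 : g x - z != 0 by rewrite subr_eq0.
  have m0 := modulus_gt0 n0.
  have -> : (f (g x) - f z) / (g x - z) - d =
      (f (g x) - f z - d * (g x - z)) / (g x - z).
    by rewrite [RHS]mulrBl mulfK.
  by rewrite modulusM modulusV ler_pdivrMr// -mulrA -expr2.
- move=> w; case: eqVneq => [->|wz]; first by rewrite subrr mulr0 addr0.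
  by rewrite divfK ?subr_eq0// addrC subrK.
Qed.

End complex_exponential.

(** * Fourier moments of the Gaussian on the half-line *)

Section half_line_integral.
Context {R : realType}.
Notation mu := (@lebesgue_measure R).
Local Notation D := (`[0, +oo[%classic : set R).
Implicit Types (f g : R -> R[i]).

Definition cint f : R[i] :=
  (\int[mu]_(t in D) complex.Re (f t)) +i*
  (\int[mu]_(t in D) complex.Im (f t)).

Definition cintegrable f : Prop :=
  mu.-integrable D (EFin \o (fun t => complex.Re (f t))) /\
  mu.-integrable D (EFin \o (fun t => complex.Im (f t))).

Lemma cintegrableD f g : cintegrable f -> cintegrable g ->
  cintegrable (fun t => f t + g t).
Proof.
move=> [f1 f2] [g1 g2]; split; under [X in EFin \o X]eq_fun do rewrite ReIm;
  exact: integrable_add.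
Qed.

Lemma cintegrableZ (c : R[i]) f : cintegrable f ->
  cintegrable (fun t => c * f t).
Proof.
move=> [f1 f2]; split; under [X in EFin \o X]eq_fun do rewrite ReIm.
- under [X in EFin \o X]eq_fun do rewrite -mulNr.
  by apply: integrable_add => //; exact: integrable_mull.
- by apply: integrable_add => //; exact: integrable_mull.
Qed.

Lemma cintD f g : cintegrable f -> cintegrable g ->
  cint (fun t => f t + g t) = cint f + cint g.
Proof.
move=> [f1 f2] [g1 g2]; apply: complex_eqP; rewrite [RHS]ReIm /= -RintegralD//;
  by apply: eq_Rintegral => t _; rewrite ReIm.
Qed.

Lemma cintZ (c : R[i]) f : cintegrable f ->
  cint (fun t => c * f t) = c * cint f.
Proof.
move=> [f1 f2]; apply: complex_eqP; rewrite [RHS]ReIm /=.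
- rewrite -!RintegralZl// -RintegralB//; try exact: integrable_mull.
  by apply: eq_Rintegral => t _; rewrite ReIm.
- rewrite -!RintegralZl// -RintegralD//; try exact: integrable_mull.
  by apply: eq_Rintegral => t _; rewrite ReIm.
Qed.

Lemma modulus_cint_le f (g : R -> R) : cintegrable f ->
  mu.-integrable D (EFin \o g) ->
  (forall t, 0 <= t -> modulus (f t) <= g t) ->
  modulus (cint f) <= 2 * \int[mu]_(t in D) g t.
Proof.
move=> [f1 f2] ig fg; rewrite mulr_natl mulr2n.
rewrite (le_trans (modulus_le _))//= lerD//.
- apply: (le_trans (le_normr_Rintegral _ f1)) => //.
  apply: le_Rintegral => //; first exact: (integrable_norm f1).
  move=> t; rewrite /= in_itv /= andbT => t0.
  by rewrite (le_trans (normr_Re_le _))// fg.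
- apply: (le_trans (le_normr_Rintegral _ f2)) => //.
  apply: le_Rintegral => //; first exact: (integrable_norm f2).
  move=> t; rewrite /= in_itv /= andbT => t0.
  by rewrite (le_trans (normr_Im_le _))// fg.
Qed.

Lemma cintegrable_dominated (f : R[i] -> R[i]) (g : R -> R) :
  (forall t : R, ccont f t%:C) -> mu.-integrable D (EFin \o g) ->
  (forall t : R, 0 <= t -> modulus (f t%:C) <= g t) ->
  cintegrable (fun t => f t%:C).
Proof.
move=> cf ig fg; split; apply: (dominated_integrable _ _ _ ig) => //.
- apply: measurable_funTS; apply: continuous_measurable_fun => t.
  exact: ccont_continuous_Re.
- move=> t; rewrite /= in_itv /= andbT => t0.
  by rewrite (le_trans (normr_Re_le _))// fg.
- apply: measurable_funTS; apply: continuous_measurable_fun => t.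
  exact: ccont_continuous_Im.
- move=> t; rewrite /= in_itv /= andbT => t0.
  by rewrite (le_trans (normr_Im_le _))// fg.
Qed.

Lemma cint_FTC (f F : R[i] -> R[i]) :
  (forall t : R, hol F t%:C (f t%:C)) -> (forall t : R, ccont f t%:C) ->
  cintegrable (fun t => f t%:C) ->
  modulus (F t%:C) @[t --> +oo] --> 0 ->
  cint (fun t => f t%:C) = - F 0%:C.
Proof.
move=> dF cf [i1 i2] F0.
have F0' : ccvg +oo (fun t : R => F t%:C) 0.
  apply: ccvg_modulus_le F0; apply: nearW => t.
  by rewrite subr0.
apply: complex_eqP; rewrite ReIm /=.
- rewrite -[RHS]sub0r; apply: (@FTC_half_line _ (fun t => complex.Re (f t%:C))
    (fun t => complex.Re (F t%:C)) 0) => //.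
  + by move=> t; exact: ccont_continuous_Re.
  + by move=> t; exact: hol_is_derive_Re.
  + by case: F0'.
- rewrite -[RHS]sub0r; apply: (@FTC_half_line _ (fun t => complex.Im (f t%:C))
    (fun t => complex.Im (F t%:C)) 0) => //.
  + by move=> t; exact: ccont_continuous_Im.
  + by move=> t; exact: hol_is_derive_Im.
  + by case: F0'.
Qed.

End half_line_integral.

Section gaussian_moments.
Context {R : realType}.
Notation mu := (@lebesgue_measure R).
Local Notation D := (`[0, +oo[%classic : set R).
Implicit Types (z w u : R[i]) (n : nat).

Lemma hol_cexp u : hol (@cexp R) u (cexp u).
Proof.
apply: (@hol_quadratic _ _ _ _ (3 * modulus (cexp u) * expR 1)) => w wu.
pose k := w - u.
have -> : cexp w = cexp u * cexp k by rewrite -cexpD /k addrC subrK.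
have -> : cexp u * cexp k - cexp u - cexp u * (w - u) =
  cexp u * (cexp k - 1 - k) by rewrite /k; ring.
rewrite modulusM mulrC -/k.
rewrite (_ : 3 * _ * _ * _ = 3 * modulus k ^+ 2 * expR 1 * modulus (cexp u)); last by ring.
rewrite ler_wpM2r ?modulus_ge0// (le_trans (modulus_cexp_taylor _))//.
by rewrite ler_wpM2l ?ler_expR// mulr_ge0// exprn_ge0// modulus_ge0.
Qed.

Definition fourier_weight n z (t : R[i]) : R[i] :=
  t ^+ n * cexp ('i * z * t - t ^+ 2 / 2).

(** The moments of the Gaussian weight on the half-line, Fourier transformed:
    [int_0^oo t^n e^(i z t - t^2 / 2) dt]. *)
Definition moment n z : R[i] := cint (fun t => fourier_weight n z t%:C).

Let hol_phase z (t : R[i]) :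
  hol (fun t => 'i * z * t - t ^+ 2 / 2) t ('i * z - t).
Proof.
have h1 : hol (fun t => 'i * z * t) t ('i * z * 1) by apply: holZ; exact: hol_id.
have h2 : hol (fun t => - (2^-1 * (t * t))) t (- (2^-1 * (1 * t + t * 1))).
  by apply: holN; apply: holZ; apply: holM; exact: hol_id.
have := holD h1 h2.
have -> : (fun w => 'i * z * w + - (2^-1 * (w * w))) =
    (fun t => 'i * z * t - t ^+ 2 / 2).
  by apply/funext => s; rewrite expr2 [X in _ - X]mulrC.
apply: hol_der_eq; field.
by [].
Qed.

Let hol_exp_phase z (t : R[i]) :
  hol (fun t => cexp ('i * z * t - t ^+ 2 / 2)) t
    (cexp ('i * z * t - t ^+ 2 / 2) * ('i * z - t)).
Proof. exact: (hol_comp (hol_phase z t) (hol_cexp _)). Qed.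

Lemma ccontX n (t : R[i]) : ccont (fun t => t ^+ n) t.
Proof.
elim: n => [|n IHn]; first exact: ccont_cst.
rewrite (_ : (fun t => _) = fun t => t * t ^+ n).
  by apply: ccontM => //; exact: ccont_id.
by apply/funext => s; rewrite exprS.
Qed.

Lemma ccont_fourier_weight n z (t : R[i]) : ccont (fourier_weight n z) t.
Proof.
by apply: ccontM; [exact: ccontX|exact: hol_ccont (hol_exp_phase z t)].
Qed.

Lemma modulus_fourier_weight n z (t : R) : 0 <= t ->
  modulus (fourier_weight n z t%:C) =
  t ^+ n * expR (- complex.Im z * t - t ^+ 2 / 2).
Proof.
move=> t0; rewrite modulusM modulusX modulus_real ger0_norm// modulus_cexp.
congr (_ * expR _).
have -> : t%:C ^+ 2 / 2 = (t ^+ 2 / 2)%:C :> R[i].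
  rewrite !real_complexM expr2 real_complexV; congr (_ / _).
  by apply: complex_eqP; rewrite /= ?mulr2n ?complexRe_D ?complexIm_D /= ?addr0.
by rewrite !ReIm /=; ring.
Qed.

Lemma cintegrable_fourier_weight n z :
  cintegrable (fun t => fourier_weight n z t%:C).
Proof.
apply: (cintegrable_dominated _ (integrable_gaussian_moment n (- complex.Im z))).
  by move=> t; exact: ccont_fourier_weight.
by move=> t t0; rewrite modulus_fourier_weight.
Qed.

Lemma fourier_weightS n z t : fourier_weight n.+1 z t = t * fourier_weight n z t.
Proof. by rewrite /fourier_weight exprS mulrA. Qed.

Lemma hol_moment n z : hol (moment n) z ('i * moment n.+1 z).
Proof.
pose g (t : R) := t ^+ n.+2 * expR ((1 - complex.Im z) * t - t ^+ 2 / 2).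
have ig : mu.-integrable D (EFin \o g) by exact: integrable_gaussian_moment.
apply: (@hol_quadratic _ _ _ _ (2 * (3 * \int[mu]_(t in D) g t))) => w wz.
pose k := w - z; rewrite -/k in wz *.
have iw := cintegrable_fourier_weight n w.
have iz := cintegrableZ (-1) (cintegrable_fourier_weight n z).
have iz1 := cintegrableZ (- 'i * k) (cintegrable_fourier_weight n.+1 z).
have -> : moment n w - moment n z - 'i * moment n.+1 z * k =
    cint (fun t => fourier_weight n w t%:C + -1 * fourier_weight n z t%:C +
                   (- 'i * k) * fourier_weight n.+1 z t%:C).
  rewrite cintD//; last exact: cintegrableD.
  rewrite cintD// (cintZ _ (cintegrable_fourier_weight n z)).
  rewrite (cintZ _ (cintegrable_fourier_weight n.+1 z)).
  by rewrite /moment; ring.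
rewrite [leRHS](_ : _ = 2 * \int[mu]_(t in D) (3 * modulus k ^+ 2 * g t)); last first.
  by rewrite RintegralZl//; ring.
apply: modulus_cint_le.
- by apply: cintegrableD => //; exact: cintegrableD.
- exact: integrable_mull.
move=> t t0.
have -> : fourier_weight n w t%:C + -1 * fourier_weight n z t%:C +
    (- 'i * k) * fourier_weight n.+1 z t%:C =
  fourier_weight n z t%:C * (cexp ('i * k * t%:C) - 1 - 'i * k * t%:C).
  rewrite fourier_weightS {1}/fourier_weight.
  have -> : 'i * w * t%:C - t%:C ^+ 2 / 2 =
    ('i * z * t%:C - t%:C ^+ 2 / 2) + 'i * k * t%:C by rewrite /k; ring.
  by rewrite cexpD mulrA -/(fourier_weight n z t%:C); ring.
rewrite modulusM modulus_fourier_weight//.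
have mk : modulus ('i * k * t%:C) = modulus k * t.
  by rewrite 2!modulusM modulusi mul1r modulus_real ger0_norm.
have := modulus_cexp_taylor ('i * k * t%:C); rewrite mk => H.
have kt : expR (modulus k * t) <= expR t by rewrite ler_expR ler_piMl.
apply: (@le_trans _ _ (t ^+ n * expR (- complex.Im z * t - t ^+ 2 / 2) *
  (3 * (modulus k * t) ^+ 2 * expR t))).
  rewrite ler_wpM2l ?mulr_ge0 ?expR_ge0 ?exprn_ge0// (le_trans H)//.
  by rewrite ler_wpM2l// mulr_ge0// exprn_ge0// mulr_ge0// modulus_ge0.
rewrite /g (_ : (1 - complex.Im z) * t - t ^+ 2 / 2 =
  (- complex.Im z * t - t ^+ 2 / 2) + t); last by ring.
rewrite (expRD (- complex.Im z * t - t ^+ 2 / 2)) (exprS t n.+1) (exprS t n) le_eqVlt; apply/orP; left; apply/eqP.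
by move: (expR _) (expR t) (t ^+ n) => e1 e2 tn; ring.
Qed.

(** The modulus is at most [2 / t] once [t] exceeds 1. *)
Let fourier_weight_decay n z : (n <= 1)%N -> 0 <= complex.Im z ->
  modulus (fourier_weight n z t%:C) @[t --> +oo] --> 0.
Proof.
move=> n1 z0.
have l : 2 * t^-1 @[t --> (+oo : set_system R)] --> 0.
  rewrite -[X in _ --> X](mulr0 2); apply: (@cvgM R); first exact: cvg_cst.
  apply/gtr0_cvgV0; last exact: cvg_id.
  exact: nbhs_pinfty_gt.
apply: (@squeeze_cvgr _ _ _ _ (cst 0) (fun t => 2 * t^-1)) => //; last first.
  exact: cvg_cst.
near=> t.
have t1 : 1 <= t by near: t; apply: nbhs_pinfty_ge.
have t0 : 0 < t by exact: lt_le_trans t1.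
rewrite modulus_ge0 /= (modulus_fourier_weight _ _ (ltW t0)).
apply: (@le_trans _ _ (t ^+ 1 * expR (- (t ^+ 2 / 2)))).
  apply: ler_pM; rewrite ?expR_ge0 ?exprn_ge0 ?(ltW t0)//.
    by rewrite ler_eXn2l// ler_weXn2l.
  by rewrite ler_expR mulNr; have := mulr_ge0 z0 (ltW t0); lra.
rewrite expr1 expRN ler_pdivrMr ?expR_gt0// mulrAC ler_pdivlMr//.
have := expR_ge1Dx (t ^+ 2 / 2); rewrite -expr2; lra.
Unshelve. all: by end_near. Qed.

(** Integration by parts: the weight is the exponential of [i z t - t^2 / 2],
    whose derivative is [i z - t]. *)
Lemma moment_relation0 z : 0 <= complex.Im z ->
  'i * z * moment 0 z - moment 1 z = - 1.
Proof.
move=> z0; have i0 := cintegrable_fourier_weight 0 z.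
have i1 := cintegrable_fourier_weight 1 z.
have H := @cint_FTC _ (fun t => 'i * z * fourier_weight 0 z t +
   -1 * fourier_weight 1 z t) (fourier_weight 0 z).
transitivity (cint (fun t => 'i * z * fourier_weight 0 z t%:C +
   -1 * fourier_weight 1 z t%:C)).
  rewrite cintD; [|exact: cintegrableZ|exact: cintegrableZ].
  by rewrite (cintZ _ i0) (cintZ _ i1) /moment; ring.
rewrite H.
- by rewrite /fourier_weight expr0 mul1r mulr0 expr0n /= mul0r subr0 cexp0.
- move=> t; have := hol_exp_phase z t%:C.
  rewrite (_ : (fun t => _) = fourier_weight 0 z); last first.
    by apply/funext => s; rewrite /fourier_weight expr0 mul1r.
  by apply: hol_der_eq; rewrite /fourier_weight; ring.
- move=> t; apply: ccontD; apply: ccontM;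
    by [exact: ccont_cst|exact: ccont_fourier_weight].
- by apply: cintegrableD; exact: cintegrableZ.
- exact: fourier_weight_decay.
Qed.

(** The same for [t] times the weight; as all moments are bounded, this shows
    that the first moment is [O(1 / z)]. *)
Lemma moment_relation1 z : 0 <= complex.Im z ->
  moment 0 z + 'i * z * moment 1 z - moment 2 z = 0.
Proof.
move=> z0; have i0 := cintegrable_fourier_weight 0 z.
have i1 := cintegrable_fourier_weight 1 z.
have i2 := cintegrable_fourier_weight 2 z.
have H := @cint_FTC _ (fun t => fourier_weight 0 z t + 'i * z * fourier_weight 1 z t +
   -1 * fourier_weight 2 z t) (fourier_weight 1 z).
transitivity (cint (fun t => fourier_weight 0 z t%:C + 'i * z * fourier_weight 1 z t%:C +
   -1 * fourier_weight 2 z t%:C)).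
  rewrite cintD; last exact: cintegrableZ; last first.
    by apply: cintegrableD => //; exact: cintegrableZ.
  rewrite cintD//; last exact: cintegrableZ.
  by rewrite (cintZ _ i1) (cintZ _ i2) /moment; ring.
rewrite H.
- by rewrite /fourier_weight mul0r oppr0.
- move=> t; have := holM (hol_id t%:C) (hol_exp_phase z t%:C).
  rewrite (_ : (fun t => _) = fourier_weight 1 z); last first.
    by apply/funext => s; rewrite /fourier_weight expr1.
  by apply: hol_der_eq; rewrite /fourier_weight; ring.
- move=> t; apply: ccontD; last by apply: ccontM; [exact: ccont_cst|exact: ccont_fourier_weight].
  apply: ccontD; first exact: ccont_fourier_weight.
  by apply: ccontM; [exact: ccont_cst|exact: ccont_fourier_weight].
- apply: cintegrableD; last exact: cintegrableZ.
  by apply: cintegrableD => //; exact: cintegrableZ.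
- exact: fourier_weight_decay.
Qed.

Lemma moment_bounded n : upper_bounded (moment n).
Proof.
exists (2 * \int[mu]_(t in D) (t ^+ n * expR (0 * t - t ^+ 2 / 2))) => z z0.
apply: modulus_cint_le.
- exact: cintegrable_fourier_weight.
- exact: integrable_gaussian_moment.
- move=> t t0; rewrite modulus_fourier_weight// ler_wpM2l ?exprn_ge0//.
  by rewrite ler_expR mul0r mulNr; have := mulr_ge0 z0 t0; lra.
Qed.

End gaussian_moments.

(** * Dawson's function and the Boolean Levy measure *)

Section dawson.
Context {R : realType}.

Lemma is_derive_expR_halfsq (x : R) :
  is_derive x 1 (fun x : R => expR (x ^+ 2 / 2)) (x * expR (x ^+ 2 / 2)).
Proof.
have d : is_derive x (1 : R) (fun x : R => x ^+ 2 / 2) x.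
  by apply: is_derive_eq; rewrite /GRing.scale /=; field.
have := @is_derive1_comp _ expR (fun x : R => x ^+ 2 / 2) x _ _
  (is_derive_expR _) d.
by move=> /is_derive_eq; apply; rewrite mulrC.
Qed.

Lemma is_derive_expRN_halfsq (x : R) :
  is_derive x 1 (fun x : R => expR (- (x ^+ 2 / 2))) (- x * expR (- (x ^+ 2 / 2))).
Proof.
have d : is_derive x (1 : R) (fun x : R => - (x ^+ 2 / 2)) (- x).
  by apply: is_derive_eq; rewrite /GRing.scale /=; field.
have := @is_derive1_comp _ expR (fun x : R => - (x ^+ 2 / 2)) x _ _
  (is_derive_expR _) d.
by move=> /is_derive_eq; apply; rewrite mulrC.
Qed.

Lemma is_derive_continuous (f df : R -> R) :
  (forall x : R, is_derive x 1 f (df x)) -> continuous f.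
Proof.
move=> d x; apply: differentiable_continuous; apply/derivable1_diffP.
by case: (d x).
Qed.

(** The integrating factor [expR (x ^+ 2 / 2)] turns the differential
    inequality into monotonicity. *)
Lemma ode_comparison (f df : R -> R) :
  (forall x : R, is_derive x 1 f (df x)) ->
  (forall x, 0 <= x -> 0 <= df x + x * f x) -> 0 <= f 0 ->
  forall x, 0 <= x -> 0 <= f x.
Proof.
move=> d dfx f0 x x0; pose F (t : R) := f t * expR (t ^+ 2 / 2).
have dF (t : R) : is_derive t 1 F ((df t + t * f t) * expR (t ^+ 2 / 2)).
  have e := is_derive_expR_halfsq t.
  by apply: is_derive_eq; rewrite /GRing.scale /=; ring.
have [|c] := @MVT_segment _ F _ 0 x x0 (fun t _ => dF t).
  by apply: continuous_subspaceT; exact: (is_derive_continuous dF).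
rewrite in_itv /= => /andP[c0 _] H.
have : 0 <= F x - F 0.
  by rewrite H subr0 !mulr_ge0 ?expR_ge0// dfx.
rewrite /F expr0n /= mul0r expR0 mulr1 subr_ge0 => /(le_trans f0).
by rewrite pmulr_lge0 ?expR_gt0.
Qed.

Variables (r : R -> R) (q0 : R).
Hypothesis dr : forall x : R, is_derive x 1 r (1 - x * r x).
Hypothesis r0 : r 0 = 0.
Hypothesis q00 : 0 < q0.
Hypothesis q02 : q0 ^+ 2 <= 2.

Let onesq_gt0 (x : R) : 0 < 1 + x ^+ 2.
Proof. by rewrite ltr_wpDr ?sqr_ge0. Qed.

Let is_derive_rational (x : R) : is_derive x 1 (fun x : R => x / (1 + x ^+ 2))
  ((1 - x ^+ 2) / (1 + x ^+ 2) ^+ 2).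
Proof.
have n0 : 1 + x ^+ 2 != 0 by rewrite gt_eqF.
have d : is_derive x (1 : R) (fun x : R => 1 + x ^+ 2) (2 * x).
  by apply: is_derive_eq; rewrite /GRing.scale /=; ring.
have dv : is_derive x (1 : R) (fun x : R => (1 + x ^+ 2)^-1) (- (1 + x ^+ 2) ^- 2 *: (2 * x)).
  exact: is_deriveV.
by apply: is_derive_eq; rewrite /GRing.scale /=; field.
Qed.

(** [x / (1 + x ^+ 2)] is a subsolution of [y' = 1 - x y], and twice it is a
    supersolution, by [(1 - x ^+ 2) ^+ 2 >= 0]. *)
Lemma dawson_ge (x : R) : 0 <= x -> x / (1 + x ^+ 2) <= r x.
Proof.
move=> x0; rewrite -subr_ge0.
pose df (t : R) := 1 - t * r t - (1 - t ^+ 2) / (1 + t ^+ 2) ^+ 2.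
apply: (@ode_comparison (fun t => r t - t / (1 + t ^+ 2)) df) => //.
- by move=> t; have d := is_derive_rational t; apply: is_derive_eq.
- move=> t t0; have n0 : 1 + t ^+ 2 != 0 by rewrite gt_eqF.
  rewrite (_ : _ + _ = 2 * t ^+ 2 / (1 + t ^+ 2) ^+ 2); last by rewrite /df; field.
  by rewrite divr_ge0 ?sqr_ge0// mulr_ge0 ?sqr_ge0.
- by rewrite r0 mul0r subrr.
Qed.

Lemma dawson_le (x : R) : 0 <= x -> r x <= 2 * (x / (1 + x ^+ 2)).
Proof.
move=> x0; rewrite -subr_ge0.
pose df (t : R) := 2 * ((1 - t ^+ 2) / (1 + t ^+ 2) ^+ 2) - (1 - t * r t).
apply: (@ode_comparison (fun t => 2 * (t / (1 + t ^+ 2)) - r t) df) => //.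
- move=> t; have d := is_derive_rational t; exact: is_derive_eq.
- move=> t t0; have n0 : 1 + t ^+ 2 != 0 by rewrite gt_eqF.
  rewrite (_ : _ + _ = (1 - t ^+ 2) ^+ 2 / (1 + t ^+ 2) ^+ 2); last by rewrite /df; field.
  by rewrite divr_ge0 ?sqr_ge0.
- by rewrite r0 mul0r mulr0 subrr.
Qed.

(** [x |G(x)|^2 / phi(x)] up to a constant factor, for the Cauchy transform
    [G = r - i q0 expR (- x ^+ 2 / 2)] of the Gaussian density [phi]: the
    reciprocal of the canonical function of the Boolean Levy measure. *)
Definition reciprocal_levy (x : R) : R :=
  x * (expR (x ^+ 2 / 2) * r x ^+ 2 + q0 ^+ 2 * expR (- (x ^+ 2 / 2))).

Let dm (x : R) : R :=
  expR (x ^+ 2 / 2) * ((1 - x ^+ 2) * r x ^+ 2 + 2 * (x * r x)) +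
  (1 - x ^+ 2) * (q0 ^+ 2 * expR (- (x ^+ 2 / 2))).

Let is_derive_m (x : R) : is_derive x 1 reciprocal_levy (dm x).
Proof.
have e1 := is_derive_expR_halfsq x; have e2 := is_derive_expRN_halfsq x.
have d := dr x.
by apply: is_derive_eq; rewrite /dm /GRing.scale /=; ring.
Qed.

(** The only negative terms carry the factor [1 - x ^+ 2]. For [x > 1] the
    two-sided bound on [r] shows that the positive term [2 x r] beats
    [(x ^+ 2 - 1) r ^+ 2], with a margin that absorbs the exponentially small
    remaining term. *)
Let dm_gt0 (x : R) : 0 < x -> 0 < dm x.
Proof.
move=> x0; set y := x * r x; set u := x ^+ 2.
have u0 : 0 < u by rewrite exprn_gt0.
have u1 : 0 < 1 + u by rewrite onesq_gt0.
have yl : u <= y * (1 + u).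
  rewrite -ler_pdivrMr// /u /y expr2 -mulrA ler_pM2l//.
  by rewrite -expr2; apply: dawson_ge; exact: ltW.
have yu : y * (1 + u) <= 2 * u.
  rewrite -ler_pdivlMr// /u /y expr2 mulrCA -!mulrA ler_pM2l//.
  by rewrite -expr2; apply: dawson_le; exact: ltW.
have y0 : 0 < y by rewrite -(pmulr_lgt0 _ u1) (lt_le_trans u0).
set E := expR (u / 2); have E0 : 0 < E by exact: expR_gt0.
have q0' : 0 < q0 ^+ 2 by rewrite exprn_gt0.
have EE : E * expR (- (u / 2)) = 1 by rewrite -expRD subrr expR0.
rewrite /dm -/u -/y -/E.
have [u1'|u1'] := leP u 1.
  have u2 : 0 <= 1 - u by rewrite subr_ge0.
  apply: ltr_pwDl.
    apply: mulr_gt0 => //; apply: ltr_wpDl; last exact: mulr_gt0.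
    exact: mulr_ge0 u2 (sqr_ge0 _).
  exact: mulr_ge0 u2 (mulr_ge0 (ltW q0') (expR_ge0 _)).
have yr : u * r x ^+ 2 = y ^+ 2 by rewrite /u /y exprMn.
(* multiplying by [u E] leaves an inequality between [E^2] and a quadratic *)
rewrite -(pmulr_rgt0 _ (mulr_gt0 u0 E0)).
rewrite (_ : u * E * _ = E ^+ 2 * (y * (2 * u - (u - 1) * y)) -
    (u - 1) * (u * q0 ^+ 2)); last first.
  transitivity (E ^+ 2 * ((1 - u) * (u * r x ^+ 2) + 2 * u * y) +
    (1 - u) * (u * q0 ^+ 2) * (E * expR (- (u / 2)))); first by ring.
  by rewrite EE yr; ring.
(* [(1 + u / 2) ^+ 2] would be too small for large [u] *)
have E2 : (1 + u / 3) ^+ 3 <= E ^+ 2.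
  have -> : E ^+ 2 = expR (u / 3) ^+ 3.
    by rewrite /E -!expRM_natl; congr expR; field.
  rewrite lerXn2r ?nnegrE ?expR_ge0 ?expR_ge1Dx// addr_ge0// divr_ge0//.
  exact: ltW.
have k1 : 4 * u <= (1 + u) * (2 * u - (u - 1) * y).
  have : (u - 1) * (y * (1 + u)) <= (u - 1) * (2 * u) by rewrite ler_wpM2l// subr_ge0 ltW.
  lra.
have k2 : u * (4 * u) <= (y * (1 + u)) * ((1 + u) * (2 * u - (u - 1) * y)).
  by apply: ler_pM => //; rewrite ?mulr_ge0 ?ltW.
rewrite subr_gt0 -(ltr_pM2r (mulr_gt0 u1 u1)).
apply: (@lt_le_trans _ _ ((1 + u / 3) ^+ 3 * (u * (4 * u)))); last first.
  rewrite [leRHS](_ : _ = E ^+ 2 * ((y * (1 + u)) * ((1 + u) * (2 * u - (u - 1) * y)))); last by ring.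
  apply: ler_pM => //; first by rewrite exprn_ge0// addr_ge0// divr_ge0// ltW.
  by rewrite mulr_ge0// ?mulr_ge0// ltW.
apply: (@le_lt_trans _ _ ((u - 1) * (u * 2) * ((1 + u) * (1 + u)))).
  rewrite ler_wpM2r ?mulr_ge0 ?(ltW u1)// ler_wpM2l ?subr_ge0 ?(ltW u1')//.
  by rewrite ler_wpM2l// ltW.
have : 0 < u * (2 * (2 / 27 * u ^+ 4 - u ^+ 3 / 3 + u ^+ 2 + 3 * u + 1)).
  rewrite !mulr_gt0//.
  have s : 2 / 27 * u ^+ 4 - u ^+ 3 / 3 + u ^+ 2 + 3 * u + 1 =
    2 / 27 * (u * (u - 9 / 4)) ^+ 2 + 5 / 8 * u ^+ 2 + 3 * u + 1 by field.
  rewrite s; have := sqr_ge0 u; have := sqr_ge0 (u * (u - 9 / 4)); lra.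
lra.
Qed.

Lemma reciprocal_levy_gt0 (x : R) : 0 < x -> 0 < reciprocal_levy x.
Proof.
move=> x0; rewrite mulr_gt0// ltr_wpDl ?mulr_gt0 ?expR_gt0 ?exprn_gt0//.
by rewrite mulr_ge0 ?expR_ge0 ?sqr_ge0.
Qed.

Lemma reciprocal_levy_increasing (x y : R) : 0 < x -> x < y ->
  reciprocal_levy x < reciprocal_levy y.
Proof.
move=> x0 xy.
have [|c] := @MVT _ reciprocal_levy _ x y xy (fun t _ => is_derive_m t).
  by apply: continuous_subspaceT; exact: (is_derive_continuous is_derive_m).
rewrite in_itv /= => /andP[xc _] H.
by rewrite -subr_gt0 H mulr_gt0 ?subr_gt0// dm_gt0// (lt_trans x0).
Qed.

End dawson.

(** * The Cauchy transform of the standard Gaussian *)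

Section gaussian_transform.
Context {R : realType}.
Notation mu := (@lebesgue_measure R).
Local Notation D := (`[0, +oo[%classic : set R).
Implicit Types (z w : R[i]) (x : R).

(** The Cauchy transform of N(0, 1), continued to an entire function by
    [1 / (z - x) = - i int_0^oo e^(i (z - x) t) dt] and the Fourier transform
    of the Gaussian. *)
Definition gauss_cauchy z : R[i] := - 'i * moment 0 z.
Local Notation G := gauss_cauchy.

Let ii : 'i * 'i = - 1 :> R[i]. Proof. by rewrite -expr2 sqr_i. Qed.

Let moment1E z : 0 <= complex.Im z -> moment 1 z = 1 - z * G z.
Proof.
move=> z0; have := moment_relation0 z0.
move/eqP; rewrite subr_eq => /eqP e; rewrite /G.
have -> : z * (- 'i * moment 0 z) = - ('i * z * moment 0 z) by ring.
by rewrite e; ring.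
Qed.

Lemma hol_gauss_cauchy z : 0 <= complex.Im z -> hol G z (1 - z * G z).
Proof.
move=> z0; apply: hol_der_eq (holZ (- 'i) (hol_moment 0 z)).
rewrite -moment1E// mulrA.
have -> : - 'i * 'i = 1 :> R[i] by rewrite mulNr ii opprK.
by rewrite mul1r.
Qed.

Lemma ccont_gauss_cauchy z : 0 <= complex.Im z -> ccont G z.
Proof. by move=> /hol_gauss_cauchy/hol_ccont. Qed.

Lemma upper_analytic_gauss_cauchy : upper_analytic G.
Proof.
apply: upper_analytic_hol hol_gauss_cauchy _ => z z0.
apply: ccontD; first exact: ccont_cst.
apply: ccontN; apply: ccontM; first exact: ccont_id.
exact: ccont_gauss_cauchy.
Qed.

Lemma upper_bounded_gauss_cauchy : upper_bounded G.
Proof. by apply: upper_boundedZ; exact: moment_bounded. Qed.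

Lemma gauss_cauchy_infinity : exists2 C : R, 0 <= C & forall z,
  0 <= complex.Im z -> modulus z * modulus (z * G z - 1) <= C.
Proof.
have [B0 H0] := @moment_bounded R 0; have [B2 H2] := @moment_bounded R 2.
have B00 : 0 <= B0 + B2.
  have i0 : 0 <= complex.Im (0 : R[i]) by [].
  apply: addr_ge0; first exact: le_trans (modulus_ge0 _) (H0 0 i0).
  exact: le_trans (modulus_ge0 _) (H2 0 i0).
exists (B0 + B2) => // z z0.
have -> : z * G z - 1 = - moment 1 z by rewrite moment1E//; ring.
rewrite modulusN -modulusM -[modulus _]mul1r -modulusi -modulusM.
have -> : 'i * (z * moment 1 z) = moment 2 z - moment 0 z.
  have := moment_relation1 z0; move/eqP; rewrite subr_eq add0r => /eqP <-.
  by ring.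
apply: (le_trans (modulusB _ _)); rewrite [leRHS]addrC; apply: lerD.
  exact: H2.
exact: H0.
Qed.

Definition dawson_part x : R := complex.Re (G x%:C).

Let real_upper x : 0 <= complex.Im x%:C. Proof. by []. Qed.

Lemma is_derive_dawson_part x :
  is_derive x 1 dawson_part (1 - x * dawson_part x).
Proof.
have := hol_is_derive_Re (hol_gauss_cauchy (real_upper x)).
by move=> /is_derive_eq; apply; rewrite !ReIm /dawson_part /=; ring.
Qed.

Let is_derive_ImG x : is_derive x 1 (fun x => complex.Im (G x%:C))
  (- x * complex.Im (G x%:C)).
Proof.
have := hol_is_derive_Im (hol_gauss_cauchy (real_upper x)).
by move=> /is_derive_eq; apply; rewrite !ReIm /=; ring.
Qed.

(** Uniqueness for the linear equation: both the imaginary part of the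
    transform on the line and the even part of [dawson_part] solve it. *)
Lemma ode_gaussian (f : R -> R) :
  (forall x : R, is_derive x 1 f (- x * f x)) ->
  forall x, f x = f 0 * expR (- (x ^+ 2 / 2)).
Proof.
move=> df x; pose F (t : R) := f t * expR (t ^+ 2 / 2).
have dF (t : R) : is_derive t (1 : R) F 0.
  have e := is_derive_expR_halfsq t; have d := df t.
  by apply: is_derive_eq; rewrite /GRing.scale /=; ring.
have := is_derive_0_is_cst x 0 dF; rewrite /F expr0n /= mul0r expR0 mulr1 => <-.
by rewrite -mulrA -expRD subrr expR0 mulr1.
Qed.

(** [int_0^oo e^(- t^2 / 2) dt]. *)
Definition gauss_half_mass : R := Num.sqrt (2 * pi) / 2.

Lemma gauss_half_mass_gt0 : 0 < gauss_half_mass.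
Proof. by rewrite divr_gt0// sqrtr_gt0 mulr_gt0// pi_gt0. Qed.

Lemma gauss_half_mass_sqr : gauss_half_mass ^+ 2 = pi / 2.
Proof.
rewrite /gauss_half_mass expr_div_n sqr_sqrtr ?mulr_ge0 ?pi_ge0//.
by move: (pi : R) => p; field.
Qed.

Let weight_real x (t : R) : fourier_weight 0 x%:C t%:C =
  (expR (- (t ^+ 2 / 2)) * cos (x * t)) +i* (expR (- (t ^+ 2 / 2)) * sin (x * t)).
Proof.
rewrite /fourier_weight expr0 mul1r /cexp.
have -> : 'i * x%:C * t%:C - t%:C ^+ 2 / 2 = (- (t ^+ 2 / 2)) +i* (x * t).
  have -> : t%:C ^+ 2 / 2 = (t ^+ 2 / 2)%:C :> R[i].
    rewrite !real_complexM expr2 real_complexV; congr (_ / _).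
    by apply: complex_eqP; rewrite /= ?mulr2n ?complexRe_D ?complexIm_D /= ?addr0.
  by apply: complex_eqP; rewrite !ReIm /=; ring.
by [].
Qed.

Let integrable_half_gauss :
  mu.-integrable D (EFin \o (fun t => expR (- (t ^+ 2 / 2)))).
Proof.
rewrite (_ : (fun t : R => expR _) =
    (fun t => t ^+ 0 * expR (0 * t - t ^+ 2 / 2))).
  exact: integrable_gaussian_moment.
by apply/funext => t; rewrite expr0 mul1r mul0r sub0r.
Qed.

Lemma integral_half_gauss :
  \int[mu]_(t in D) expR (- (t ^+ 2 / 2)) = gauss_half_mass.
Proof.
pose f (t : R) := expR (- (t ^+ 2 / 2)).
have cf : continuous f.
  exact: (is_derive_continuous (@is_derive_expRN_halfsq R)).
have p0 : normal_peak (1 : R) != 0 by rewrite gt_eqF// normal_peak_gt0 ?oner_neq0.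
have fE t : f t = (normal_peak 1)^-1 * normal_pdf 0 1 t.
  rewrite normal_pdfE ?oner_neq0// mulKf// /normal_fun /f subr0 expr1n.
  by rewrite mulNr.
have I1 : \int[mu]_t f t = (normal_peak 1)^-1.
  under eq_Rintegral do rewrite fE.
  rewrite RintegralZl//; last exact: integrable_normal_pdf.
  by rewrite /Rintegral integral_normal_pdf /= mulr1.
have I2 : \int[mu]_t f t = 2 * \int[mu]_(t in D) f t.
  rewrite /Rintegral ge0_symfun_integralT//; last 2 first.
  - by move=> t; exact: expR_ge0.
  - by move=> t; rewrite /f /= sqrrN.
  rewrite -set_itvcy fineM//.
  exact: (integrable_fin_num _ integrable_half_gauss).
have -> : \int[mu]_(t in D) expR (- (t ^+ 2 / 2)) = (normal_peak 1)^-1 / 2.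
  by rewrite -I1 I2 mulrC mulKf.
rewrite /gauss_half_mass /normal_peak invrK expr1n mul1r.
by rewrite mulr_natl.
Qed.

Let Im_mulNi z : complex.Im (- 'i * z) = - complex.Re z.
Proof. by rewrite !ReIm /=; ring. Qed.

Let Re_moment0 z : complex.Re (moment 0 z) =
  \int[mu]_(t in D) complex.Re (fourier_weight 0 z t%:C).
Proof. by []. Qed.

Let Im_moment0 z : complex.Im (moment 0 z) =
  \int[mu]_(t in D) complex.Im (fourier_weight 0 z t%:C).
Proof. by []. Qed.

Lemma Im_gauss_cauchy_real x :
  complex.Im (G x%:C) = - (gauss_half_mass * expR (- (x ^+ 2 / 2))).
Proof.
rewrite (ode_gaussian is_derive_ImG) -[RHS]mulNr; congr (_ * _).
rewrite Im_mulNi; congr (- _).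
rewrite -integral_half_gauss Re_moment0; apply: eq_Rintegral => t _.
by rewrite weight_real /= mul0r cos0 mulr1.
Qed.

Lemma dawson_part0 : dawson_part 0 = 0.
Proof.
rewrite /dawson_part Re_mulNi Im_moment0.
rewrite (_ : \int[mu]_(t in D) _ = \int[mu]_(t in D) 0); last first.
  by apply: eq_Rintegral => t _; rewrite weight_real /= mul0r sin0 mulr0.
by rewrite Rintegral_cst// mul0r.
Qed.

Lemma dawson_partN x : dawson_part (- x) = - dawson_part x.
Proof.
pose f (t : R) := dawson_part t + dawson_part (- t).
have df (t : R) : is_derive t 1 f (- t * f t).
  have d1 := is_derive_dawson_part t.
  have d2 : is_derive t (1 : R) (fun t => dawson_part (- t))
      ((1 - (- t) * dawson_part (- t)) * -1).
    apply: (@is_derive1_comp _ dawson_part (fun t : R => - t) t).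
      exact: is_derive_dawson_part.
  have := is_deriveD d1 d2; move=> /is_derive_eq; apply; rewrite /f; ring.
have := ode_gaussian df x; rewrite /f oppr0 dawson_part0 addr0 mul0r.
by move/eqP; rewrite addrC addr_eq0 => /eqP.
Qed.

Lemma Rintegral_gt0 (f : R -> R) : continuous f -> (forall x, 0 < f x) ->
  mu.-integrable setT (EFin \o f) -> 0 < \int[mu]_x f x.
Proof.
move=> cf f0 intf.
have [c _ cmin] := @EVT_min _ f 0 1 ler01 (continuous_subspaceT cf).
have i01 : mu.-integrable `[0, 1] (EFin \o f).
  by apply: integrableS intf.
apply: (@lt_le_trans _ _ (f c)) => //.
have -> : f c = \int[mu]_(x in `[0, 1]) f c.
  by rewrite Rintegral_cst//= lebesgue_measure_itv /= lte_fin ltr01 oppr0 adde0 mulr1.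
apply: (@le_trans _ _ (\int[mu]_(x in `[0, 1]) f x)).
  have ic : mu.-integrable `[0, 1] (EFin \o fun=> f c).
    apply: continuous_compact_integrable; first exact: segment_compact.
    by apply: continuous_subspaceT => y; exact: cvg_cst.
  by apply: le_Rintegral => // x x01; apply: cmin; rewrite inE.
rewrite Rintegral_mkcond; apply: le_Rintegral => //.
  rewrite -restrict_EFin; apply/integrable_restrict => //=.
  by rewrite setTI.
by move=> x _; rewrite patchE; case: ifPn => // _; exact: ltW.
Qed.

End gaussian_transform.

(** * Dilations, K-transforms and selfdecomposability *)

Section dilations.
Context {R : realType}.
Notation mu := (@lebesgue_measure R).
Implicit Types (z : R[i]) (nu : probability (measurableTypeR R) R).

Let scaled_upper (k : R) z : 0 < k -> 0 < complex.Im z ->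
  0 < complex.Im (k%:C * z).
Proof. by move=> k0 z0; rewrite !ReIm /= mul0r addr0 mulr_gt0. Qed.

Lemma integrable_cauchy_kernel nu z : 0 < complex.Im z ->
  nu.-integrable setT (EFin \o (fun x => complex.Re (1 / (z - x%:C)))) /\
  nu.-integrable setT (EFin \o (fun x => complex.Im (1 / (z - x%:C)))).
Proof.
move=> z0; split; apply: (@bounded_integrable _ _ _ (complex.Im z)^-1).
- apply: continuous_measurable_fun => x.
  by apply: (@ccont_continuous_Re _ (fun w => 1 / (z - w)));
    exact: ccont_cauchy_kernel.
- by move=> x; exact: le_trans (normr_Re_le _) (modulus_cauchy_kernel x z0).
- apply: continuous_measurable_fun => x.
  by apply: (@ccont_continuous_Im _ (fun w => 1 / (z - w)));
    exact: ccont_cauchy_kernel.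
- by move=> x; exact: le_trans (normr_Im_le _) (modulus_cauchy_kernel x z0).
Qed.

Lemma cauchy_transform_dilation nu (c : R) z : 0 < c -> 0 < complex.Im z ->
  cauchy_transform (dilation c nu) z =
  c^-1%:C * cauchy_transform nu (c^-1%:C * z).
Proof.
move=> c0 z0; have c0' : c != 0 by rewrite gt_eqF.
have cV0 : 0 < c^-1 by rewrite invr_gt0.
have z1 := scaled_upper cV0 z0.
have [iR iI] := integrable_cauchy_kernel nu z1.
have cC0 : c%:C != 0 :> R[i] by apply/eqP => -[/eqP]; rewrite gt_eqF.
have E (x : R) : 1 / (z - (c * x)%:C) = c^-1%:C * (1 / (c^-1%:C * z - x%:C)).
  have n1 : z - (c * x)%:C != 0.
    by apply: upper_neq0; rewrite !ReIm /= oppr0 addr0.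
  have n2 : c^-1%:C * z - x%:C != 0.
    by apply: upper_neq0; rewrite !ReIm /= mul0r oppr0 !addr0 mulr_gt0.
  have -> : z - (c * x)%:C = c%:C * (c^-1%:C * z - x%:C).
    by rewrite real_complexM mulrBr mulrA real_complexV divff// mul1r.
  by rewrite real_complexV !mul1r invfM.
have key (g : R[i] -> R) (k : R -> R) : (g = @complex.Re R \/ g = @complex.Im R) ->
   \int[dilation c nu]_x g (1 / (z - x%:C)) =
   c^-1 * \int[nu]_x g (1 / (c^-1%:C * z - x%:C)).
  move=> gRI.
  have gM (r : R) (u : R[i]) : g (r%:C * u) = r * g u.
    by case: gRI => ->; rewrite !ReIm /= mul0r ?subr0 ?addr0.
  have [j1 j2] := integrable_cauchy_kernel (dilation c nu) z0.
  have ig : nu.-integrable setT (EFin \o (fun x => g (1 / (c^-1%:C * z - x%:C)))).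
    by case: gRI => ->.
  have jg : (dilation c nu).-integrable setT (EFin \o (fun x => g (1 / (z - x%:C)))).
    by case: gRI => ->.
  have gE : (fun x => g (1 / (z - (c * x)%:C))) =
      (fun x => c^-1 * g (1 / (c^-1%:C * z - x%:C))).
    by apply/funext => x; rewrite E gM.
  rewrite -RintegralZl// -gE /Rintegral; congr fine.
  rewrite integral_distribution//; first exact: measurable_int jg.
  rewrite (_ : _ \o _ = fun x => (c^-1 * g (1 / (c^-1%:C * z - x%:C)))%:E).
    rewrite (_ : (fun x => _) = fun x => (c^-1%:E * (g (1 / (c^-1%:C * z - x%:C)))%:E)%E).
      exact: integrableZl.
    by apply/funext => x; rewrite EFinM.
  by apply/funext => x; rewrite /= /scale E gM.
rewrite /cauchy_transform; apply: complex_eqP; rewrite [RHS]ReIm /=.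
- by rewrite mul0r subr0; apply: key; [exact: id|left].
- by rewrite mul0r addr0; apply: key; [exact: id|right].
Qed.

Lemma K_transform_dilation nu (c : R) z : 0 < c -> 0 < complex.Im z ->
  K_transform (dilation c nu) z = c%:C * K_transform nu (c^-1%:C * z).
Proof.
move=> c0 z0; rewrite /K_transform /F_transform cauchy_transform_dilation//.
have cC0 : c%:C != 0 :> R[i] by apply/eqP => -[/eqP]; rewrite gt_eqF.
by rewrite real_complexV !div1r invfM invrK [RHS]mulrBr mulVKf.
Qed.

End dilations.

Section gaussian_K.
Context {R : realType}.
Notation mu := (@lebesgue_measure R).
Local Notation G := (@gauss_cauchy R).
Implicit Types (z : R[i]) (x : R).

(** By Poisson's formula, from the explicit negative boundary values. *)
Lemma Im_gauss_cauchy_lt0 z : 0 <= complex.Im z -> complex.Im (G z) < 0.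
Proof.
have real_lt0 x : complex.Im (G x%:C) < 0.
  by rewrite Im_gauss_cauchy_real oppr_lt0 mulr_gt0 ?expR_gt0 ?gauss_half_mass_gt0.
rewrite le_eqVlt => /predU1P[z0|z0].
  by rewrite (_ : z = (complex.Re z)%:C)//; apply: complex_eqP.
have ug := @upper_analytic_gauss_cauchy R; have bg := @upper_bounded_gauss_cauchy R.
have ig := integrable_poisson_Im (complex.Re z) ug bg z0.
rewrite -(pmulr_rlt0 _ (pi_gt0 R)) -(poisson_Im ug bg z0) -oppr_gt0 -mulN1r.
rewrite -RintegralZl//; apply: Rintegral_gt0.
- move=> x; apply: (@cvgM R); first exact: cvg_cst.
  apply: (@cvgM R); first exact: continuous_poisson_kernel.
  by apply: ccont_continuous_Im; exact: ccont_gauss_cauchy.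
- by move=> x; rewrite mulN1r -mulrN mulr_gt0 ?poisson_kernel_gt0 ?oppr_gt0.
- exact: integrable_mull.
Qed.

Lemma gauss_cauchy_neq0 z : 0 <= complex.Im z -> G z != 0.
Proof.
by move=> /Im_gauss_cauchy_lt0; apply: contraTneq => -> /=; rewrite ltxx.
Qed.

Definition gauss_K z : R[i] := z - (G z)^-1.
Local Notation K := gauss_K.

Lemma upper_analytic_gauss_K : upper_analytic K.
Proof.
apply: upper_analyticD; first exact: upper_analytic_id.
apply: upper_analyticN; apply: upper_analyticV gauss_cauchy_neq0.
exact: upper_analytic_gauss_cauchy.
Qed.

(** [K = (z G - 1) / G], where [z G - 1 = O(1 / z)] and [G] is of order
    [1 / z] at infinity. *)
Lemma upper_bounded_gauss_K : upper_bounded K.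
Proof.
have [C C0 HC] := @gauss_cauchy_infinity R.
apply: (@upper_bounded_infinity _ _ (2 * C + 1) (2 * C)).
  exact: upper_analytic_gauss_K.
move=> z z0 zC; have G0 := gauss_cauchy_neq0 z0.
have zz : 0 < modulus z by rewrite (lt_trans _ zC)//; lra.
have -> : K z = (z * G z - 1) / G z by rewrite /K; field.
have z00 : z != 0 by apply: contraTneq zz => ->; rewrite modulus0 ltxx.
have H := HC z z0.
have g1 : modulus (z * G z - 1) <= 1 / 2.
  have : modulus z * modulus (z * G z - 1) <= modulus z * (1 / 2) by lra.
  by rewrite ler_pM2l.
have g2 : 1 / 2 <= modulus z * modulus (G z).
  have : modulus (1 : R[i]) <= modulus (z * G z) + modulus (z * G z - 1).
    by rewrite [X in modulus X <= _](_ : _ = z * G z - (z * G z - 1)) ?modulusB//; ring.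
  by rewrite modulus1 -modulusM; lra.
rewrite modulusM modulusV ler_pdivrMr ?modulus_gt0//.
rewrite -(ler_pM2l zz) (le_trans H)//.
have := ler_wpM2l C0 g2; lra.
Qed.

(** For [x > 0], [Im (c K(x / c) - K(x))] is a positive multiple of
    [x (1 / m(x) - 1 / m(x / c))] with [m] the increasing function
    [reciprocal_levy]; [Im K] is even on the line. This is the unimodality of
    the Boolean Levy measure. *)
Lemma gauss_K_unimodal (c x : R) : 0 < c -> c < 1 ->
  0 < complex.Im (c%:C * K (c^-1%:C * x%:C) - K x%:C).
Proof.
move=> c0 c1; have c0' : c != 0 by rewrite gt_eqF.
pose q0 := @gauss_half_mass R; have q00 : 0 < q0 by exact: gauss_half_mass_gt0.
have q02 : q0 ^+ 2 <= 2.
  by rewrite gauss_half_mass_sqr ltW// pihalf_lt2.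
pose r := @dawson_part R; pose e (t : R) := expR (- (t ^+ 2 / 2)).
pose p (t : R) := q0 * e t / (r t ^+ 2 + (q0 * e t) ^+ 2).
have pE t : complex.Im (K t%:C) = - p t.
  rewrite /K complexIm_D complexIm_N complexIm_V Im_gauss_cauchy_real /=.
  by rewrite -/(r t) sqrrN opprK add0r.
have pN t : p (- t) = p t.
  by rewrite /p /r /e dawson_partN !sqrrN.
have e0 t : 0 < e t by exact: expR_gt0.
have p0 t : 0 < p t.
  apply: divr_gt0; first exact: mulr_gt0.
  by apply: ltr_wpDl; [exact: sqr_ge0|apply: exprn_gt0; exact: mulr_gt0].
suff H : c * p (c^-1 * x) < p x.
  have Im_cM (w : R[i]) : complex.Im (c%:C * w) = c * complex.Im w.
    by rewrite complexIm_M /= mul0r addr0.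
  rewrite -real_complexM complexIm_D complexIm_N Im_cM.
  by rewrite !pE opprK mulrN addrC subr_gt0.
have main (y : R) : 0 < y -> c * p (c^-1 * y) < p y.
  move=> y0; pose m := reciprocal_levy r q0.
  have pm (t : R) : 0 < t -> p t = q0 * t / m t.
    move=> t0; have m0 := reciprocal_levy_gt0 r q00 t0; rewrite -/m in m0.
    have mE : m t = t / e t * (r t ^+ 2 + (q0 * e t) ^+ 2).
      rewrite /m /reciprocal_levy -/(e t) (_ : expR (t ^+ 2 / 2) = (e t)^-1).
        by field; rewrite gt_eqF.
      by rewrite /e expRN invrK.
    have n0 : r t ^+ 2 + (q0 * e t) ^+ 2 != 0.
      rewrite gt_eqF//; apply: ltr_wpDl; first exact: sqr_ge0.
      by apply: exprn_gt0; exact: mulr_gt0.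
    by rewrite mE /p; field; rewrite n0 !gt_eqF.
  have yc : y < c^-1 * y by rewrite ltr_pMl// invf_gt1.
  have yc0 : 0 < c^-1 * y by rewrite mulr_gt0// invr_gt0.
  have mm := reciprocal_levy_increasing (@is_derive_dawson_part R)
    (@dawson_part0 R) q00 q02 y0 yc.
  have m0 := reciprocal_levy_gt0 r q00 y0.
  rewrite !pm// (_ : c * _ = q0 * y / m (c^-1 * y)).
    by rewrite (ltr_pM2l (mulr_gt0 q00 y0)) ltf_pV2 ?posrE// (lt_trans m0).
  by rewrite (mulrCA q0) mulrA mulVKf.
have [x0|x0|->] := ltgtP x 0.
- rewrite -(pN (_ * x)) -(pN x) -mulrN; apply: main.
  by rewrite oppr_gt0.
- exact: main.
- by rewrite mulr0 gtr_pMl.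
Qed.

End gaussian_K.

Section selfdecomposability.
Context {R : realType}.
Notation mu := (@lebesgue_measure R).
Local Notation G := (@gauss_cauchy R).
Local Notation K := (@gauss_K R).
Implicit Types (z : R[i]) (x : R).

Let scaled_upper (k : R) z : 0 < k -> 0 <= complex.Im z ->
  0 <= complex.Im (k%:C * z).
Proof. by move=> k0 z0; rewrite !ReIm /= mul0r addr0 mulr_ge0// ltW. Qed.

Let upper_bounded_scaled (k : R) (f : R[i] -> R[i]) : 0 < k ->
  upper_bounded f -> upper_bounded (fun z => f (k%:C * z)).
Proof. by move=> k0 [B HB]; exists B => z z0; exact/HB/scaled_upper. Qed.

(** The boundary density of [- G] is the Gaussian density, so this is an
    instance of Cauchy's formula; the dilation by [s] is carried along. *)
Lemma cauchy_transform_normal (s : R) z : 0 < s -> 0 < complex.Im z ->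
  cauchy_transform (normal_prob 0 s) z = s^-1%:C * G (s^-1%:C * z).
Proof.
move=> s0 z0; have sV0 : 0 < s^-1 by rewrite invr_gt0.
pose g z := - G z.
have ug : upper_analytic g by exact/upper_analyticN/upper_analytic_gauss_cauchy.
have bg : upper_bounded g.
  have [B HB] := @upper_bounded_gauss_cauchy R.
  by exists B => w w0; rewrite modulusN HB.
have bzg : upper_bounded (fun z => z * g z).
  have [C _ HC] := @gauss_cauchy_infinity R.
  apply: (@upper_bounded_mulz _ _ C) => // w w0.
  rewrite (_ : w * g w + 1 = - (w * G w - 1)); last by rewrite /g; ring.
  by rewrite modulusN; exact: HC.
pose h z := s^-1%:C * g (s^-1%:C * z).
have uh : upper_analytic h by exact/upper_analyticZ/upper_analytic_dilation.
have bh : upper_bounded h by exact/upper_boundedZ/upper_bounded_scaled.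
have bzh : upper_bounded (fun z => z * h z).
  have [B HB] := upper_bounded_scaled sV0 bzg.
  exists B => w w0; rewrite (_ : w * h w = s^-1%:C * w * g (s^-1%:C * w)).
    exact: HB.
  by rewrite /h; ring.
have hE x : complex.Im (h x%:C) = s^-1 * (gauss_half_mass * expR (- ((s^-1 * x) ^+ 2 / 2))).
  rewrite /h /g -real_complexM complexIm_M complexIm_N Im_gauss_cauchy_real /=.
  by rewrite opprK mul0r addr0.
have h0 x : 0 <= complex.Im (h x%:C).
  by rewrite hE !mulr_ge0 ?expR_ge0 ?(ltW sV0)// ltW// gauss_half_mass_gt0.
rewrite (@cauchy_transform_boundary _ _ uh bh bzh h0)//.
  by rewrite /h /g mulrN opprK.
move=> A mA; rewrite /normal_prob; apply: eq_integral => x _; congr EFin.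
rewrite normal_pdfE ?gt_eqF// /boundary_density hE /normal_fun subr0.
have -> : - ((s^-1 * x) ^+ 2 / 2) = - x ^+ 2 / (s ^+ 2 *+ 2).
  by field; rewrite gt_eqF.
rewrite mulrA [RHS]mulrAC; congr (_ * _).
rewrite /normal_peak /gauss_half_mass.
have -> : s ^+ 2 * pi *+ 2 = s ^+ 2 * (2 * pi) by rewrite -mulr_natl; ring.
rewrite sqrtrM ?sqr_ge0// sqrtr_sqr gtr0_norm//.
have k0 : 0 < Num.sqrt (2 * pi) :> R by rewrite sqrtr_gt0 mulr_gt0// pi_gt0.
have k2 : Num.sqrt (2 * pi) ^+ 2 = 2 * pi :> R.
  by rewrite sqr_sqrtr// mulr_ge0// pi_ge0.
move: k0 k2; move: (Num.sqrt (2 * pi)) => k; move: (pi : R) => p k0 k2.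
have -> : p = k ^+ 2 / 2 by rewrite k2 mulrC mulKf.
by field; rewrite !gt_eqF.
Qed.

Lemma K_transform_normal (s : R) z : 0 < s -> 0 < complex.Im z ->
  K_transform (normal_prob 0 s) z = s%:C * K (s^-1%:C * z).
Proof.
move=> s0 z0; rewrite /K_transform /F_transform cauchy_transform_normal//.
have sC0 : s%:C != 0 :> R[i] by apply/eqP => -[/eqP]; rewrite gt_eqF.
by rewrite /K real_complexV div1r invfM invrK [RHS]mulrBr mulVKf.
Qed.

(** With [h1 z = c K(z / c) - K(z)], the sought F-transform is [z + h1 z].
    Poisson's formula propagates [Im h1 >= 0] from the line to the half-plane,
    so [z + h1 z] does not vanish there and [- 1 / (z + h1 z)] can be realized
    as minus a Cauchy transform. *)
Lemma exists_standard_cofactor (c : R) : 0 < c -> c < 1 ->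
  exists nu : probability (measurableTypeR R) R, forall z, 0 < complex.Im z ->
    K_transform nu z = K z - c%:C * K (c^-1%:C * z).
Proof.
move=> c0 c1; have cV0 : 0 < c^-1 by rewrite invr_gt0.
pose h1 z := c%:C * K (c^-1%:C * z) - K z.
have uK := @upper_analytic_gauss_K R; have bK := @upper_bounded_gauss_K R.
have uh1 : upper_analytic h1.
  apply: upper_analyticD; last exact: upper_analyticN.
  by apply: upper_analyticZ; exact: upper_analytic_dilation.
have [B HB] : upper_bounded h1.
  case: bK (upper_boundedZ c%:C (upper_bounded_scaled cV0 bK)) => [B1 HB1] [B2 HB2].
  exists (B2 + B1) => z z0; rewrite (le_trans (modulusB _ _))//.
  by apply: lerD; [exact: HB2|exact: HB1].
have bh1 : upper_bounded h1 by exists B.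
have h1_real x : 0 < complex.Im (h1 x%:C) by exact: gauss_K_unimodal.
have h1_ge0 z : 0 <= complex.Im z -> 0 <= complex.Im (h1 z).
  rewrite le_eqVlt => /predU1P[z0|z0].
    by rewrite (_ : z = (complex.Re z)%:C) ?ltW//; apply: complex_eqP.
  rewrite -(pmulr_rge0 _ (pi_gt0 R)) -(poisson_Im uh1 bh1 z0).
  apply: Rintegral_ge0 => x _; rewrite mulr_ge0 ?poisson_kernel_ge0 ?ltW//.
pose F z := z + h1 z.
have uF : upper_analytic F by apply: upper_analyticD => //; exact: upper_analytic_id.
have F0 z : 0 <= complex.Im z -> F z != 0.
  move=> z0; apply: upper_neq0; rewrite /F complexIm_D.
  move: z0; rewrite le_eqVlt => /predU1P[z0|z0].
    rewrite -z0 add0r (_ : z = (complex.Re z)%:C)//.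
    by apply: complex_eqP.
  by rewrite ltr_pwDl// h1_ge0// ltW.
have Fl z : 0 <= complex.Im z -> modulus z - B <= modulus (F z).
  move=> z0; rewrite lerBlDr.
  rewrite {1}(_ : z = F z - h1 z); last by rewrite /F; ring.
  by rewrite (le_trans (modulusB _ _))// lerD2l HB.
pose h z := - (F z)^-1.
have uh : upper_analytic h by apply: upper_analyticN; exact: upper_analyticV.
have B0 : 0 <= B by rewrite (le_trans (modulus_ge0 _) (HB 0 _)).
have bh : upper_bounded h.
  apply: (@upper_bounded_infinity _ _ (B + 1) 1) => // z z0 zB.
  rewrite modulusN modulusV invf_le1 ?modulus_gt0 ?F0//.
  by have := Fl z z0; lra.
have [C HC] : upper_bounded (fun z => z * (z * h z + 1)).
  apply: (@upper_bounded_infinity _ _ (2 * B) (2 * B)).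
    apply: upper_analyticM; first exact: upper_analytic_id.
    apply: upper_analyticD; last exact: upper_analytic_cst.
    by apply: upper_analyticM => //; exact: upper_analytic_id.
  move=> z z0 zB; have Fz := F0 z z0.
  have -> : z * h z + 1 = h1 z / F z.
    have -> : h1 z = F z - z by rewrite /F; ring.
    by rewrite /h; field.
  rewrite 2!modulusM modulusV mulrA ler_pdivrMr ?modulus_gt0//.
  have H1 := ler_wpM2l (modulus_ge0 z) (HB z z0).
  have H2 : B * modulus z <= B * (2 * modulus (F z)).
    by apply: ler_wpM2l => //; have := Fl z z0; lra.
  lra.
have hC z : 0 <= complex.Im z -> modulus z * modulus (z * h z + 1) <= C.
  by move=> z0; rewrite -modulusM; exact: HC.
have hI x : 0 <= complex.Im (h x%:C).
  have Fx : 0 <= complex.Im (F x%:C) by rewrite /F complexIm_D [complex.Im _%:C]/= add0r ltW.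
  rewrite /h complexIm_N complexIm_V mulNr opprK divr_ge0//.
  by rewrite addr_ge0 ?sqr_ge0.
have [nu nuE] := cauchy_transform_realization uh bh hC hI.
exists nu => z z0; rewrite /K_transform /F_transform nuE// /h opprK div1r invrK.
by rewrite /F /h1; ring.
Qed.

End selfdecomposability.

(* The second parameter of [normal_prob] is the standard deviation. *)
Theorem theorem4p3 (R : realType) (v : R) (v_gt0 : 0 < v) :
  boolean_selfdecomposable (normal_prob 0 (Num.sqrt v)).
Proof.
move=> c /andP[c0 c1]; set s := Num.sqrt v.
have s0 : 0 < s by rewrite sqrtr_gt0.
have [nu nuE] := exists_standard_cofactor c0 c1.
exists (dilation s nu) => z z0.
have sV0 : 0 < s^-1 by rewrite invr_gt0.
have cV0 : 0 < c^-1 by rewrite invr_gt0.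
have up (k : R) : 0 < k -> 0 < complex.Im (k%:C * z).
  by move=> k0; rewrite !ReIm /= mul0r addr0 mulr_gt0.
rewrite !K_transform_dilation// !K_transform_normal ?up// nuE ?up//.
have -> : s^-1%:C * (c^-1%:C * z) = c^-1%:C * (s^-1%:C * z) by ring.
by ring.
Qed.
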